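(* Let $X$ be a finite set, $E\subset X\times X$ such that the directed graph $(X,E)$ is strongly connected, and $\Sigma=\{x\in X^{\mathbb N_0}:(x_n,x_{n+1})\in E\ \forall n\}$ the associated transitive topological Markov shift. Let $J\subset\mathbb R$ be an open interval and assume: (1) for each $t\in J$, $P(t)=(P_{ij}(t))_{i,j\in X}$ is a row-stochastic matrix with $P_{ij}(t)>0$ if and only if $(i,j)\in E$, and $t\mapsto P_{ij}(t)$ is real analytic for all $i,j$; (2) for each $i\in X$, $t\mapsto A_i(t)\in\mathrm{GL}_2(\mathbb R)$ is real analytic on $J$. If $t_0\in J$ and the family $\{A_i(t_0)\}_{i\in X}$ is projectively uniformly hyperbolic with respect to $\Sigma$, then $t\mapsto\lambda_+\big(A(t),P(t)\big)$ is real analytic on a neighborhood of $t_0$.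
   Context: For an irreducible row-stochastic $P$ on $X$ with stationary probability vector $p$, $\mu$ is the Markov measure on $\Sigma$ with $\mu([i_0,\dots,i_n])=p_{i_0}P_{i_0i_1}\cdots P_{i_{n-1}i_n}$, and for $\{A_i\}\subset\mathrm{GL}_2(\mathbb R)$, $\lambda_+(A,P)$ is the $\mu$-a.e. constant value of $\lim_n\frac1n\log\|A_{x_{n-1}}\cdots A_{x_0}\|$. Projective uniform hyperbolicity w.r.t. $\Sigma$: on $\widehat\Sigma=\{(x_n)_{n\in\mathbb Z}:(x_n,x_{n+1})\in E\ \forall n\}$ with left shift $\widehat\sigma$ there is a continuous splitting $\mathbb R^2=E^d(\hat x)\oplus E^w(\hat x)$ into one-dimensional subspaces with $A_{x_0}E^*(\hat x)=E^*(\widehat\sigma\hat x)$ ($*=d,w$), and some $n\ge1$ with $\|A_{x_{n-1}}\cdots A_{x_0}|_{E^w(\hat x)}\|<\|A_{x_{n-1}}\cdots A_{x_0}|_{E^d(\hat x)}\|$ for every $\hat x\in\widehat\Sigma$. *)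

(* Defs.v *)
From HB Require Import structures.
From mathcomp Require Import all_boot all_order all_algebra.
From mathcomp Require Import all_classical all_reals all_analysis.
Import Order.TTheory GRing.Theory Num.Theory.
Import numFieldNormedType.Exports.

Set Implicit Arguments.
Unset Strict Implicit.
Unset Printing Implicit Defensive.

Local Open Scope classical_set_scope.
Local Open Scope ring_scope.

Definition real_analytic_on {R : realType} (U : set R) (f : R -> R) : Prop :=
  forall t0, U t0 -> exists a : nat -> R, exists r : R, 0 < r /\
    forall t, `|t - t0| < r ->
      (fun n => \sum_(k < n) a k * (t - t0) ^+ k) @ \oo --> f t.

Definition one_sided_shift {X : finType} (E : rel X) : set (nat -> X) :=
  [set x | forall n, E (x n) (x n.+1)].
Definition two_sided_shift {X : finType} (E : rel X) : set (int -> X) :=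
  [set x | forall n : int, E (x n) (x (n + 1))].
Definition shift2 {X : Type} (x : int -> X) : int -> X := fun n => x (n + 1).

Fixpoint cocycle {R : ringType} {X : Type} (A : X -> 'M[R]_2) (x : nat -> X)
  (n : nat) : 'M[R]_2 :=
  match n with
  | 0 => 1%:M
  | m.+1 => A (x m) *m cocycle A x m
  end.

Definition enorm {R : realType} (v : 'cV[R]_2) : R :=
  Num.sqrt (\sum_(i < 2) v i 0 ^+ 2).
Definition opnorm {R : realType} (M : 'M[R]_2) : R :=
  sup [set enorm (M *m v) | v in [set v : 'cV[R]_2 | enorm v = 1]].

Definition row_stochastic {R : realType} {X : finType} (P : X -> X -> R) : Prop :=
  (forall i j, 0 <= P i j) /\ (forall i, \sum_j P i j = 1).
Definition stationary_prob {R : realType} {X : finType} (P : X -> X -> R)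
  (p : X -> R) : Prop :=
  [/\ forall i, 0 <= p i, \sum_i p i = 1 & forall j, \sum_i p i * P i j = p j].

Definition cylinder {X : Type} (w : nat -> X) (n : nat) : set (nat -> X) :=
  [set x | forall k, (k <= n)%N -> x k = w k].

(* xi is a random sequence on (T, mu) whose law is the Markov measure mu_P,
   i.e. mu(xi^{-1}[i_0..i_n]) = p_{i_0} P_{i_0 i_1} ... P_{i_{n-1} i_n} *)
Definition markov_process {R : realType} {X : finType} (P : X -> X -> R)
  {d} {T : measurableType d} (mu : probability T R) (xi : T -> nat -> X) : Prop :=
  exists p, stationary_prob P p /\
    forall (w : nat -> X) (n : nat),
      measurable (xi @^-1` cylinder w n) /\
      mu (xi @^-1` cylinder w n) = (p (w 0%N) * \prod_(k < n) P (w k) (w k.+1))%:E.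

Definition lyap_exp {R : realType} {X : finType} (A : X -> 'M[R]_2)
  (P : X -> X -> R) (l : R) : Prop :=
  forall d (T : measurableType d) (mu : probability T R) (xi : T -> nat -> X),
    markov_process P mu xi ->
    {ae mu, forall w, (fun n : nat => n%:R^-1 * ln (opnorm (cocycle A (xi w) n)))
                       @ \oo --> l}.

(* the line spanned by v, encoded by its orthogonal projection matrix *)
Definition proj_line {R : realType} (v : 'cV[R]_2) : 'M[R]_2 :=
  (enorm v ^+ 2)^-1 *: (v *m v^T).

Definition line_field_continuous {R : realType} {X : finType} (E : rel X)
  (L : (int -> X) -> 'cV[R]_2) : Prop :=
  forall x, two_sided_shift E x -> forall eps : R, 0 < eps ->
    exists N : nat, forall y, two_sided_shift E y ->
      (forall k : int, `|k| <= N%:Z -> y k = x k) ->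
      forall i j, `|proj_line (L y) i j - proj_line (L x) i j| < eps.

Definition proj_unif_hyp {R : realType} {X : finType} (E : rel X)
  (A : X -> 'M[R]_2) : Prop :=
  exists Ed Ew : (int -> X) -> 'cV[R]_2,
    [/\ (forall x, two_sided_shift E x ->
           forall a b : R, a *: Ed x + b *: Ew x = 0 -> a = 0 /\ b = 0),
        line_field_continuous E Ed, line_field_continuous E Ew,
        (forall x, two_sided_shift E x ->
           (exists c : R, A (x 0) *m Ed x = c *: Ed (shift2 x)) /\
           (exists c : R, A (x 0) *m Ew x = c *: Ew (shift2 x)))
      & exists n : nat, (1 <= n)%N /\
          forall x, two_sided_shift E x ->
            let M := cocycle A (fun k : nat => x (Posz k)) n in
            enorm (M *m Ew x) / enorm (Ew x) < enorm (M *m Ed x) / enorm (Ed x)].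

(* Main.v *)
(* Proof idea. A function given near c by a power series with sum |a_k| r^k <= C
   is said to have Wiener norm at most C; these norms are submultiplicative and
   complete, and shrinking r makes the norm of f - f(c) small.

   Near t0, projective hyperbolicity provides finitely many bases, indexed by
   words of length 2N+1, in which every admissible matrix D acts on slopes
   s in [-1, 1] as a strict contraction s |-> (D10 + D11 s) / (D00 + D01 s).
   The inequalities on D expressing this are open, and they make sense for Wiener
   norms, so that the same estimates hold for real numbers and for
   analytic functions of t.

   The cocycle grows along a path like the product of the factors D00 + D01 s, so
   one needs the average of ln |D00 + D01 s| over the chain (word, slope).  This is
   obtained from the Poisson equation G = lambda + H - PH, where PH is the
   conditional mean of H: the dependence on s is removed by iterating the
   contraction (a geometric series in Wiener norm) and the rest is a finite linear
   system, solved by Cramer's rule.  Hence lambda is analytic.  The Poisson equation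
   turns the ergodic averages into a martingale with bounded increments, and a
   fourth moment bound with the Borel-Cantelli lemma gives almost sure convergence
   to lambda. *)
Require Import Defs.
From HB Require Import structures.
From mathcomp Require Import all_boot all_order all_algebra.
From mathcomp Require Import all_classical all_reals all_analysis.
From mathcomp Require Import ring lra.
Import Order.TTheory GRing.Theory Num.Theory.
Import numFieldNormedType.Exports.
Set Implicit Arguments.
Unset Strict Implicit.
Unset Printing Implicit Defensive.
Local Open Scope classical_set_scope.
Local Open Scope ring_scope.

(** * Power series with a Wiener norm *)

(** Uniform limits of real analytic functions need not be analytic, so estimates at real [t] alone
    cannot give the result; a weighted l1 norm of coefficients replaces complexification. In that
    algebra only norms are visible, which is why the cone conditions are written with absolute
    values of entries: they must control a Neumann series for the denominator. The hyperbolic bases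
    depend on a whole bi-infinite path, while Cramer's rule asks for finitely many states. One
    representative path per word is frozen, so the bases do not move with [t]; the price is small
    off-diagonal entries, absorbed by strictness. Transitions that no path realizes stay in the
    chain with a default matrix. The chain on all words is then not irreducible in general, and what
    remains is that one fixed word is reached from every word. A word sees [N] letters before its
    centre, so growth is measured from time [N] on and the first [N] factors are undone by an
    invertible matrix. The operator norm is recovered from the two initial slopes 0 and 1, which
    give independent vectors of one cone. *)

Section Series.
Variable R : realType.
Implicit Types (u C : nat -> R) (l M e x : R).

Lemma cvg_le_bound u l M : u @ \oo --> l -> (forall n, u n <= M) -> l <= M.
Proof.
move=> ul uM; rewrite -(cvg_lim (@Rhausdorff R) ul).
by apply: limr_le; [apply: cvgP ul|exact: nearW].
Qed.

Lemma cvg_norm_bound u l M : u @ \oo --> l -> (forall n, `|u n| <= M) ->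
  `|l| <= M.
Proof. by move=> ul uM; apply: cvg_le_bound uM; exact: cvg_norm ul. Qed.

Lemma eq_cvgn (u v : nat -> R) l : u =1 v -> u @ \oo --> l -> v @ \oo --> l.
Proof. by move=> /funext ->. Qed.

Lemma cvgnB (u v : nat -> R) l M : u @ \oo --> l -> v @ \oo --> M ->
  (fun n => u n - v n) @ \oo --> l - M.
Proof. by move=> ul vM; apply: cvgB. Qed.

Lemma cvgnD (u v : nat -> R) l M : u @ \oo --> l -> v @ \oo --> M ->
  (fun n => u n + v n) @ \oo --> l + M.
Proof. by move=> ul vM; apply: cvgD. Qed.

Lemma cvgn_cst l : (fun _ : nat => l) @ \oo --> l.
Proof. exact: cvg_cst. Qed.

Lemma cvgn_addn (u : nat -> R) l m : u @ \oo --> l ->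
  (fun n => u (n + m)%N) @ \oo --> l.
Proof. by move=> ul; rewrite (cvg_shiftn m u). Qed.

Lemma cvg_sumr (T : Type) (F : set_system T) {FF : Filter F} (I : Type)
    (s : seq I) (f : I -> T -> R) (g : I -> R) :
  (forall i, f i @ F --> g i) ->
  (fun t => \sum_(i <- s) f i t) @ F --> \sum_(i <- s) g i.
Proof.
move=> fg; elim: s => [|i s ih].
  by under eq_fun do rewrite big_nil; rewrite big_nil; exact: cvg_cst.
by under eq_fun do rewrite big_cons; rewrite big_cons; apply: cvgD.
Qed.

(** The bound on [u n - v n] is uniform in [n]; this is what later allows two limits to be
    exchanged. *)
Lemma cvg_approx (u : nat -> R) l :
  (forall e, 0 < e -> exists (v : nat -> R) (m : R),
    [/\ v @ \oo --> m, forall n, `|u n - v n| <= e & `|l - m| <= e]) ->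
  u @ \oo --> l.
Proof.
move=> h; apply/cvgrPdist_lt => e e0.
have e4 : 0 < e / 4 by lra.
have [v [m [/cvgrPdist_lt vm uv lm]]] := h _ e4.
near=> n.
have vn : `|m - v n| < e / 4 by near: n; exact: vm.
have -> : l - u n = (l - m) + (m - v n) - (u n - v n) by ring.
apply: (le_lt_trans (ler_normB _ _)).
have := ler_normD (l - m) (m - v n); have := uv n; lra.
Unshelve. all: by end_near. Qed.

Lemma abs_bounded_series_cvg u M : (forall n, \sum_(k < n) `|u k| <= M) ->
  cvgn (fun n => \sum_(k < n) u k).
Proof.
move=> uM.
have -> : (fun n => \sum_(k < n) u k) = series u.
  by apply/funext => n; rewrite /series /= big_mkord.
apply: (@normed_cvg R R^o); apply: nondecreasing_is_cvgn.
  by apply: nondecreasing_series => n _ _; exact: normr_ge0.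
by exists M => _ [n _ <-]; rewrite /normed_series_of /series /= big_mkord.
Qed.

Lemma bounded_series_tail C D : (forall j, 0 <= C j) ->
  (forall m, \sum_(j < m) C j <= D) ->
  forall e, 0 < e -> exists m, forall n, \sum_(j < n) C (m + j)%N <= e.
Proof.
move=> C0 CD e e0.
have : cvgn (fun n => \sum_(k < n) C k).
  apply: (@abs_bounded_series_cvg _ D) => n.
  by under eq_bigr do rewrite ger0_norm//.
move=> /cvg_ex[l /= Cl].
have Cle n : \sum_(k < n) C k <= l.
  have ndC : nondecreasing_seq (fun n => \sum_(k < n) C k).
    by apply/nondecreasing_seqP => k; rewrite big_ord_recr /= lerDl.
  rewrite -(cvg_lim (@Rhausdorff R) Cl); apply: nondecreasing_cvgn_le => //.
  exact: cvgP Cl.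
have /cvgrPdist_lt/(_ _ e0)[m _ /(_ m (leqnn m)) Cm] := Cl.
exists m => n; have := Cle (m + n)%N; rewrite big_split_ord /=.
by move: Cm; rewrite ltr_norml => /andP[_]; lra.
Qed.

Lemma sum_exprn_le x n : 0 <= x -> x < 1 -> \sum_(k < n) x ^+ k <= (1 - x)^-1.
Proof.
move=> x0 x1; rewrite -[leRHS]mul1r ler_pdivlMr ?subr_gt0// mulrC.
by rewrite -opprB mulNr -subrX1 opprB lerBlDr lerDl exprn_ge0.
Qed.

End Series.

Section Wiener.
Variables (R : realType) (c r : R).
Hypothesis r0 : 0 < r.
Implicit Types (a b : nat -> R) (f g u v : R -> R) (C D t q d : R).

(** An upper bound rather than a norm: bounding every partial sum keeps infinite sums out of the
    statement. *)
Definition wiener (c r : R) f C := exists a,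
  (forall n, \sum_(k < n) `|a k| * r ^+ k <= C) /\
  (forall t, `|t - c| < r ->
     (fun n => \sum_(k < n) a k * (t - c) ^+ k) @ \oo --> f t).

Lemma eq_wiener f g C : (forall t, `|t - c| < r -> f t = g t) ->
  wiener c r f C -> wiener c r g C.
Proof.
by move=> fg [a [aC af]]; exists a; split=> // t tr; rewrite -fg//; exact: af.
Qed.

Lemma wienerW f C D : C <= D -> wiener c r f C -> wiener c r f D.
Proof. by move=> CD [a [aC af]]; exists a; split=> // n; exact: le_trans CD. Qed.

Lemma wiener_ge0 f C : wiener c r f C -> 0 <= C.
Proof. by case=> a [/(_ 0%N)]; rewrite big_ord0. Qed.

Lemma wiener_cst (k : R) : wiener c r (fun=> k) `|k|.
Proof.
exists (fun n => if n is 0%N then k else 0); split=> [[|n]|t tr].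
- by rewrite big_ord0.
- by rewrite big_ord_recl big1 ?expr0 ?mulr1 ?addr0// => i _; rewrite normr0 mul0r.
- apply: cvg_near_cst; exists 1%N => // -[//|n] _ /=.
  rewrite big_ord_recl big1 ?expr0 ?mulr1 ?addr0// => i _.
  by rewrite mul0r.
Qed.

Lemma wienerD f g C D : wiener c r f C -> wiener c r g D ->
  wiener c r (fun t => f t + g t) (C + D).
Proof.
move=> [a [aC af]] [b [bD bg]]; exists (fun k => a k + b k); split=> [n|t tr].
- apply: le_trans (lerD (aC n) (bD n)); rewrite -big_split /=.
  apply: ler_sum => k _; rewrite -mulrDl.
  by rewrite ler_wpM2r ?exprn_ge0 ?ler_normD// ltW.
- under eq_fun do under eq_bigr do rewrite mulrDl.
  under eq_fun do rewrite big_split.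
  by apply: cvgD; [exact: af|exact: bg].
Qed.

(** The product of two partial sums of length [n] differs from the partial sum of the Cauchy product
    by terms of degrees [n] to [2n - 1]. These are dominated by a tail of the Cauchy product of the
    absolute values. *)
Lemma wienerM f g C D : wiener c r f C -> wiener c r g D ->
  wiener c r (fun t => f t * g t) (C * D).
Proof.
move=> [a [aC af]] [b [bD bg]].
pose cc (a b : nat -> R) n := \sum_(k < n.+1) a k * b (n - k)%N.
have prodE (a' b' : nat -> R) n x :
    (\sum_(k < n) a' k * x ^+ k) * (\sum_(k < n) b' k * x ^+ k) -
    \sum_(m < n) cc a' b' m * x ^+ m =
    \sum_(n <= m < n + n) (\sum_(k < m.+1 | (k < n)%N && (m - k < n)%N)
       a' k * b' (m - k)%N) * x ^+ m.
  pose p := \poly_(i < n) a' i; pose q := \poly_(i < n) b' i.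
  have ev (z : nat -> R) : \sum_(k < n) z k * x ^+ k = (\poly_(i < n) z i).[x].
    by rewrite horner_poly.
  rewrite !ev -hornerM.
  have spq : (size (p * q)%R <= n + n)%N.
    apply: leq_trans (size_polyMleq _ _) _; apply: leq_trans (leq_pred _) _.
    by apply: leq_add; exact: size_poly.
  rewrite (horner_coef_wide _ spq) -(big_mkord xpredT (fun i => (p * q)`_i * x ^+ i)).
  rewrite (@big_cat_nat _ _ _ n) ?leq_addr//= horner_poly big_mkord.
  have -> : \sum_(i < n) (p * q)`_i * x ^+ i = \sum_(i < n) cc a' b' i * x ^+ i.
    apply: eq_bigr => i _; rewrite coefM; congr (_ * _); apply: eq_bigr => k _.
    by rewrite !coef_poly (leq_ltn_trans _ (ltn_ord i))
      ?(leq_ltn_trans (leq_subr _ _) (ltn_ord i))// -ltnS.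
  rewrite addrAC subrr add0r; apply: eq_big_nat => m /andP[nm _]; congr (_ * _).
  rewrite coefM [RHS]big_mkcond /=; apply: eq_bigr => k _; rewrite !coef_poly.
  by case: ifP => _; case: ifP => _; rewrite ?mul0r ?mulr0.
pose a1 k : R := `|a k|; pose b1 k : R := `|b k|.
have a0 k : 0 <= a1 k by exact: normr_ge0.
have b0 k : 0 <= b1 k by exact: normr_ge0.
have cc0 m : 0 <= cc a1 b1 m by apply: sumr_ge0 => k _; rewrite mulr_ge0.
have diff_le n x : `| (\sum_(k < n) a k * x ^+ k) * (\sum_(k < n) b k * x ^+ k) -
    \sum_(m < n) cc a b m * x ^+ m | <= \sum_(n <= m < n + n) cc a1 b1 m * `|x| ^+ m.
  rewrite prodE; apply: le_trans (ler_norm_sum _ _ _) _; apply: ler_sum => m _.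
  rewrite normrM normrX ler_wpM2r ?exprn_ge0//.
  apply: le_trans (ler_norm_sum _ _ _) _; rewrite /cc big_mkcond /=.
  by apply: ler_sum => k _; case: ifP => _; rewrite ?normrM// mulr_ge0.
(* For nonnegative coefficients the difference computed in [prodE] is nonnegative, so the Cauchy
   product is bounded by the product of the partial sums. *)
have ccD n x : 0 <= x -> x <= r -> \sum_(m < n) cc a1 b1 m * x ^+ m <= C * D.
  move=> x0 xr; have h (z : nat -> R) : (forall k, 0 <= z k) ->
      \sum_(k < n) z k * x ^+ k <= \sum_(k < n) z k * r ^+ k.
    move=> z0; apply: ler_sum => k _; rewrite ler_wpM2l//.
    by rewrite lerXn2r// nnegrE ltW.
  have s0 (z : nat -> R) : (forall k, 0 <= z k) -> 0 <= \sum_(k < n) z k * x ^+ k.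
    by move=> z0; apply: sumr_ge0 => k _; rewrite mulr_ge0 ?exprn_ge0.
  apply: le_trans (_ : (\sum_(k < n) a1 k * x ^+ k) * (\sum_(k < n) b1 k * x ^+ k) <= _).
    rewrite -subr_ge0 prodE; apply: sumr_ge0 => m _.
    by rewrite mulr_ge0 ?exprn_ge0//; apply: sumr_ge0 => k _; rewrite mulr_ge0.
  apply: ler_pM; [exact: s0|exact: s0|apply: le_trans (aC n)|apply: le_trans (bD n)];
  exact: h.
exists (cc a b); split=> [n|t tr].
- apply: le_trans (ccD n r (ltW r0) (lexx _)); apply: ler_sum => m _.
  rewrite ler_wpM2r ?exprn_ge0 ?(ltW r0)//.
  by apply: le_trans (ler_norm_sum _ _ _) _; apply: ler_sum => k _; rewrite normrM.
- have fg : (fun n => (\sum_(k < n) a k * (t - c) ^+ k) *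
      (\sum_(k < n) b k * (t - c) ^+ k)) @ \oo --> f t * g t.
    by apply: cvgM; [exact: af|exact: bg].
  apply/cvgrPdist_lt => e e0.
  have e2 : 0 < e / 2 by lra.
  have h0 j : 0 <= cc a1 b1 j * `|t - c| ^+ j by rewrite mulr_ge0 ?exprn_ge0.
  have [m tl] := @bounded_series_tail R _ (C * D) h0
     (fun n => ccD n _ (normr_ge0 _) (ltW tr)) _ e2.
  move/cvgrPdist_lt : fg => /(_ _ e2) fg.
  near=> n.
  have mn : (m <= n)%N by near: n; exact: nbhs_infty_ge.
  have := diff_le n (t - c).
  have tn : \sum_(n <= m < n + n) cc a1 b1 m * `|t - c| ^+ m <= e / 2.
    apply: le_trans (tl (n + n - m)%N).
    have <- : \sum_(m <= j < n + n) cc a1 b1 j * `|t - c| ^+ j =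
        \sum_(j < n + n - m) cc a1 b1 (m + j)%N * `|t - c| ^+ (m + j).
      by rewrite -{1}[m]add0n big_addn big_mkord; apply: eq_bigr => i _; rewrite addnC.
    by rewrite [leRHS](@big_cat_nat _ _ _ n) ?leq_addr//= ler_wpDl ?sumr_ge0.
  have := near fg n; rewrite /=.
  move=> /(_ _)/wrap[]; first by [].
  set A := \sum_(k < n) cc a b k * _; set B := (\sum_(k < n) a k * _) * _ => h1 h2.
  have -> : f t * g t - A = (f t * g t - B) + (B - A) by ring.
  apply: le_lt_trans (ler_normD _ _) _; lra.
Unshelve. all: by end_near. Qed.

(** Completeness of the norm. The coefficients are summed over [j] degree by degree, and the tail in
    [j] is small uniformly in the degree of truncation, which justifies the change of order. *)
Lemma wiener_series (F : nat -> R -> R) (C : nat -> R) D f :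
  (forall j, wiener c r (F j) (C j)) -> (forall m, \sum_(j < m) C j <= D) ->
  (forall t, `|t - c| < r -> (fun m => \sum_(j < m) F j t) @ \oo --> f t) ->
  wiener c r f D.
Proof.
move=> Fw CD Ff; have C0 j : 0 <= C j := wiener_ge0 (Fw j).
have [a ah] := choice Fw.
have aC j k : `|a j k| * r ^+ k <= C j.
  have := (ah j).1 k.+1; rewrite big_ord_recr /=; apply: le_trans.
  by rewrite lerDr sumr_ge0// => i _; rewrite mulr_ge0 ?exprn_ge0// ltW.
have cv k : cvgn (fun m => \sum_(j < m) a j k).
  apply: (@abs_bounded_series_cvg _ (a^~ k) (D / r ^+ k)) => m.
  rewrite ler_pdivlMr ?exprn_gt0// mulr_suml; apply: le_trans (CD m).
  exact: ler_sum.
pose b k := lim ((fun m => \sum_(j < m) a j k) @ \oo).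
have bl k : (fun m => \sum_(j < m) a j k) @ \oo --> b k := cv k.
have swap n x m : \sum_(k < n) (\sum_(j < m) a j k) * x ^+ k =
    \sum_(j < m) \sum_(k < n) a j k * x ^+ k.
  by rewrite exchange_big /=; apply: eq_bigr => k _; rewrite mulr_suml.
have bS n x : (fun m => \sum_(j < m) \sum_(k < n) a j k * x ^+ k) @ \oo -->
    \sum_(k < n) b k * x ^+ k.
  have -> : (fun m => \sum_(j < m) \sum_(k < n) a j k * x ^+ k) =
      (fun m => \sum_(k < n) (\sum_(j < m) a j k) * x ^+ k).
    by apply/funext => m; rewrite swap.
  by apply: cvg_sumr => k; apply: cvgMr_tmp; exact: bl.
have Sle j n x : `|x| <= r -> `|\sum_(k < n) a j k * x ^+ k| <= C j.
  move=> xr; apply: le_trans ((ah j).1 n).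
  apply: le_trans (ler_norm_sum _ _ _) _; apply: ler_sum => k _.
  by rewrite normrM normrX ler_wpM2l// lerXn2r// nnegrE// ltW.
exists b; split=> [n|t tr].
- have : (fun m => \sum_(k < n) `|\sum_(j < m) a j k| * r ^+ k) @ \oo -->
     \sum_(k < n) `|b k| * r ^+ k.
    by apply: cvg_sumr => k; apply: cvgMr_tmp; apply: cvg_norm; exact: bl.
  move/cvg_le_bound; apply => m; apply: le_trans (CD m).
  apply: le_trans (_ : \sum_(j < m) \sum_(k < n) `|a j k| * r ^+ k <= _).
    rewrite exchange_big /=; apply: ler_sum => k _; rewrite -mulr_suml.
    by rewrite ler_wpM2r ?ler_norm_sum// exprn_ge0// ltW.
  by apply: ler_sum => j _; exact: (ah j).1.
- apply: cvg_approx => e e0.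
  have [m tl] := bounded_series_tail C0 CD e0.
  exists (fun n => \sum_(j < m) \sum_(k < n) a j k * (t - c) ^+ k),
    (\sum_(j < m) F j t); split.
  + by apply: cvg_sumr => j; exact: (ah j).2.
  + move=> n; have h := cvgnB (@cvgn_addn R _ _ m (bS n (t - c)))
      (@cvgn_cst R (\sum_(j < m) \sum_(k < n) a j k * (t - c) ^+ k)).
    apply: (cvg_norm_bound h) => k /=.
    rewrite addnC big_split_ord /= addrAC subrr add0r.
    apply: le_trans (tl k); apply: le_trans (ler_norm_sum _ _ _) _.
    by apply: ler_sum => i _; exact: Sle (ltW tr).
  + have h := cvgnB (@cvgn_addn R _ _ m (Ff t tr)) (@cvgn_cst R (\sum_(j < m) F j t)).
    apply: (cvg_norm_bound h) => k /=.
    rewrite addnC big_split_ord /= addrAC subrr add0r.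
    apply: le_trans (tl k); apply: le_trans (ler_norm_sum _ _ _) _.
    apply: ler_sum => i _; have := (ah (m + i)%N).2 t tr.
    by move/cvg_norm_bound; apply => n; exact: Sle (ltW tr).
Qed.

Lemma wiener_bound f C t : `|t - c| < r -> wiener c r f C -> `|f t| <= C.
Proof.
move=> tr [a [aC af]]; apply: cvg_norm_bound (af _ tr) _ => n.
apply: le_trans (aC n); apply: le_trans (ler_norm_sum _ _ _) _.
apply: ler_sum => k _; rewrite normrM normrX ler_wpM2l// lerXn2r// ?nnegrE ?ltW//.
Qed.

Lemma wienerZ (k : R) f C : wiener c r f C -> wiener c r (fun t => k * f t) (`|k| * C).
Proof. by apply: wienerM; exact: wiener_cst. Qed.

Lemma wienerN f C : wiener c r f C -> wiener c r (fun t => - f t) C.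
Proof.
move=> /(wienerZ (-1)); rewrite normrN1 mul1r.
by apply: eq_wiener => t _; rewrite mulN1r.
Qed.

Lemma wienerB f g C D : wiener c r f C -> wiener c r g D ->
  wiener c r (fun t => f t - g t) (C + D).
Proof. by move=> fC /wienerN; exact: wienerD. Qed.

Lemma wiener_sum (I : Type) (s : seq I) (F : I -> R -> R) (C : I -> R) :
  (forall i, wiener c r (F i) (C i)) ->
  wiener c r (fun t => \sum_(i <- s) F i t) (\sum_(i <- s) C i).
Proof.
move=> FC; elim: s => [|i s ih].
  have := wiener_cst 0; rewrite big_nil normr0; apply: eq_wiener => t _.
  by rewrite big_nil.
rewrite big_cons; apply: eq_wiener (wienerD (FC i) ih) => t _.
by rewrite big_cons.
Qed.

Lemma wienerX f C n : wiener c r f C -> wiener c r (fun t => f t ^+ n) (C ^+ n).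
Proof.
move=> fC; elim: n => [|n ih].
  by rewrite expr0 -normr1; apply: eq_wiener (wiener_cst 1) => t _; rewrite expr0.
by rewrite exprS; apply: eq_wiener (wienerM fC ih) => t _; rewrite exprS.
Qed.

Lemma wiener_inv u q : wiener c r u q -> q < 1 ->
  wiener c r (fun t => (1 + u t)^-1) (1 - q)^-1.
Proof.
move=> uq q1; have q0 := wiener_ge0 uq.
apply: (@wiener_series (fun j t => (- u t) ^+ j) (fun j => q ^+ j)).
- by move=> j; apply: wienerX; exact: wienerN.
- by move=> m; exact: sum_exprn_le.
- move=> t tr; have ut : `|- u t| < 1.
    by rewrite normrN; apply: le_lt_trans q1; exact: wiener_bound uq.
  have := cvg_geometric_series (a := 1) ut; rewrite opprK mul1r.
  apply: cvg_trans; apply: near_eq_cvg; apply: nearW => n.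
  by rewrite /series /= big_mkord; apply: eq_bigr => i _; rewrite mul1r.
Qed.

(** The factor [n.+1] comes from the number of terms in the factorization of a difference of powers;
    the denominators of the logarithm series cancel it. *)
Lemma wienerXB u v q d n : wiener c r u q -> wiener c r v q ->
  wiener c r (fun t => u t - v t) d ->
  wiener c r (fun t => u t ^+ n.+1 - v t ^+ n.+1) (d * (q ^+ n *+ n.+1)).
Proof.
move=> uq vq uvd.
have := wienerM uvd (@wiener_sum _ (index_enum 'I_n.+1)
  (fun i t => u t ^+ (n - i) * v t ^+ i) _
  (fun i => wienerM (wienerX (n - i) uq) (wienerX i vq))).
have -> : \sum_(i < n.+1) q ^+ (n - i) * q ^+ i = q ^+ n *+ n.+1.
  under eq_bigr => i _ do rewrite -exprD subnK -1?ltnS//.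
  by rewrite sumr_const card_ord.
by apply: eq_wiener => t _; rewrite subrXX; congr (_ * _); apply: eq_bigr.
Qed.

(** The error [G n] vanishes at 0 and its derivative is a single geometric remainder, so the mean
    value theorem bounds it by a multiple of [|x| ^+ n]. *)
Lemma ln1D_series (x : R) : `|x| < 1 ->
  (fun n => \sum_(j < n) (-1) ^+ j * x ^+ j.+1 / j.+1%:R) @ \oo --> ln (1 + x).
Proof.
move=> x1.
pose G n (y : R) := \sum_(j < n) (-1) ^+ j * y ^+ j.+1 / j.+1%:R - ln (1 + y).
have gt0 (y : R) : `|y| < 1 -> 0 < 1 + y.
  by move=> /ltr_normlP[y1 _]; lra.
have dG n (y : R) : `|y| < 1 -> is_derive y 1 (G n) (- ((- y) ^+ n / (1 + y))).
  move=> y1; have y0 := gt0 _ y1.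
  have d1 : is_derive y 1 (fun y : R => ln (1 + y)) (1 + y)^-1.
    have := @is_derive1_comp _ (@ln R) (fun y => 1 + y) y (1 + y)^-1 1
      (is_derive1_ln y0).
    by rewrite mulr1; apply; rewrite -[X in is_derive _ _ _ X]add0r; apply: is_deriveD.
  have d2 : is_derive y 1 (fun y : R => \sum_(j < n) (-1) ^+ j * y ^+ j.+1 / j.+1%:R)
      (\sum_(j < n) (- y) ^+ j).
    have -> : (fun y : R => \sum_(j < n) (-1) ^+ j * y ^+ j.+1 / j.+1%:R) =
       \sum_(j < n) (fun y => ((-1) ^+ j / j.+1%:R) *: y ^+ j.+1).
      apply/funext => z; rewrite fct_sumE; apply: eq_bigr => j _.
      by rewrite /GRing.scale /=; ring.
    apply: is_derive_sum => j.
    have -> : (- y) ^+ j = ((-1) ^+ j / j.+1%:R) *: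
        ((j.+1%:R * (@id R) y ^+ j) *: (1 : R)).
      rewrite /GRing.scale /= mulr1 [LHS]exprNn.
      have : j.+1%:R != 0 :> R by rewrite pnatr_eq0.
      by move=> h; field.
    have -> : (fun z => ((-1) ^+ j / j.+1%:R) *: z ^+ j.+1) =
        ((-1) ^+ j / j.+1%:R) *: ((@id R) ^+ j.+1).
      by apply/funext => z; rewrite /= exprfctE.
    by apply: is_deriveZ; apply: (is_deriveX j.+1).
  have -> : - ((- y) ^+ n / (1 + y)) = \sum_(j < n) (- y) ^+ j - (1 + y)^-1.
    have n0 : 1 + y != 0 by rewrite gt_eqF.
    apply: (mulIf n0); rewrite mulrBl mulNr divfK// mulVf//.
    have := subrX1 (- y) n => h.
    have -> : (\sum_(i < n) (- y) ^+ i) * (1 + y) =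
       - ((- y - 1) * \sum_(i < n) (- y) ^+ i) by ring.
    by rewrite -h; ring.
  exact: is_deriveB.
have mvt n : `|G n x| <= `|x| ^+ n / (1 - `|x|).
  have x1' : 0 < 1 - `|x| by rewrite subr_gt0.
  have G0 : G n 0 = 0.
    rewrite /G addr0 ln1 subr0 big1// => j _.
    by rewrite expr0n /= mulr0 mul0r.
  have key (y : R) : `|y| <= `|x| ->
      `|- ((- y) ^+ n / (1 + y))| * `|x| <= `|x| ^+ n / (1 - `|x|).
    move=> yx; rewrite normrN normrM normrX normrN normfV -mulrA.
    apply: ler_pM; rewrite ?exprn_ge0 ?mulr_ge0 ?invr_ge0//.
      by rewrite lerXn2r// nnegrE.
    have h1 : 1 - `|x| <= `|1 + y|.
      by have := lerB_normD 1 y; rewrite normr1; lra.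
    apply: le_trans (_ : `|1 + y|^-1 <= _).
      by rewrite ler_piMr ?invr_ge0// ltW.
    by rewrite lef_pV2 ?posrE//; exact: lt_le_trans h1.
  have cG (a b : R) : -1 < a -> b < 1 -> {within `[a, b], continuous (G n)}.
    move=> a1 b1; apply: derivable_within_continuous => y.
    rewrite in_itv /= => /andP[ay yb].
    have y1 : `|y| < 1 by rewrite ltr_norml; apply/andP; split; lra.
    by have [] := dG n y y1.
  have [xn|xp|x0] := ltgtP x 0.
  - have xN : `|x| = - x by rewrite ltr0_norm.
    have xm1 : -1 < x by move: x1; rewrite xN; lra.
    have [||y yin Gy] := @MVT _ (G n) (fun y => - ((- y) ^+ n / (1 + y))) x 0 xn.
    + move=> y; rewrite in_itv /= => /andP[ay yb]; apply: dG.
      by rewrite ltr_norml; apply/andP; split; lra.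
    + by apply: cG => //; lra.
    move: yin; rewrite in_itv /= => /andP[ay yb].
    have -> : G n x = - (- ((- y) ^+ n / (1 + y)) * (0 - x)) by rewrite -Gy G0; ring.
    rewrite normrN normrM sub0r [`|- x|]normrN; apply: key.
    by rewrite xN ltr0_norm//; lra.
  - have xN : `|x| = x by rewrite gtr0_norm.
    have xm1 : x < 1 by move: x1; rewrite xN; lra.
    have [||y yin Gy] := @MVT _ (G n) (fun y => - ((- y) ^+ n / (1 + y))) 0 x xp.
    + move=> y; rewrite in_itv /= => /andP[ay yb]; apply: dG.
      by rewrite ltr_norml; apply/andP; split; lra.
    + by apply: cG => //; lra.
    move: yin; rewrite in_itv /= => /andP[ay yb].
    have -> : G n x = (- ((- y) ^+ n / (1 + y)) * (x - 0)) by rewrite -Gy G0; ring.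
    rewrite normrM subr0; apply: key.
    by rewrite xN gtr0_norm//; lra.
  - by rewrite x0 G0 normr0 subr0 invr1 mulr1 exprn_ge0.
have gx : (fun n => `|x| ^+ n / (1 - `|x|)) @ \oo --> (0 : R).
  rewrite -[X in _ --> X](mul0r (1 - `|x|)^-1); apply: cvgMr_tmp.
  by apply: cvg_expr; rewrite normr_id.
have : G ^~ x @ \oo --> (0 : R).
  apply/norm_cvg0P; apply: squeeze_cvgr gx; last exact: cvg_cst.
  by apply: nearW => n; rewrite normr_ge0 mvt.
move=> h; have := cvgnD h (@cvgn_cst R (ln (1 + x))); rewrite add0r.
by apply: eq_cvgn => n; rewrite /G /cst /= subrK.
Qed.

(** A difference of logarithms serves twice: it gives the Lipschitz dependence on the slope and,
    with [v] zero, the bound on one logarithm. *)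
Lemma wiener_ln1DB u v q d : wiener c r u q -> wiener c r v q -> q < 1 ->
  wiener c r (fun t => u t - v t) d ->
  wiener c r (fun t => ln (1 + u t) - ln (1 + v t)) (d / (1 - q)).
Proof.
move=> uq vq q1 uvd; have q0 := wiener_ge0 uq; have d0 := wiener_ge0 uvd.
apply: (@wiener_series
  (fun j t => ((-1) ^+ j / j.+1%:R) * (u t ^+ j.+1 - v t ^+ j.+1))
  (fun j => d * q ^+ j)).
- move=> j; have := wienerZ ((-1) ^+ j / j.+1%:R) (wienerXB j uq vq uvd).
  apply: wienerW; rewrite normrM normrX normrN1 expr1n mul1r normfV normr_nat.
  have j0 : j.+1%:R != 0 :> R by rewrite pnatr_eq0.
  by rewrite -[q ^+ j *+ _]mulr_natr [leLHS]mulrC -!mulrA divff ?mulr1.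
- by move=> m; rewrite -mulr_sumr ler_wpM2l// sum_exprn_le.
- move=> t tr; have lt1 w : wiener c r w q -> `|w t| < 1.
    by move=> wq; apply: le_lt_trans q1; exact: wiener_bound wq.
  have := cvgnB (ln1D_series (lt1 _ uq)) (ln1D_series (lt1 _ vq)).
  apply: eq_cvgn => n.
  rewrite -sumrB; apply: eq_bigr => j _.
  by ring.
Qed.

End Wiener.

(** * Analytic germs: shrinking the radius, algebra, quotients *)

Section Shrink.
Variable R : realType.
Implicit Types (f : R -> R) (c r C t e : R).

Lemma wiener_shrink c r r' f C : 0 < r' -> r' <= r ->
  wiener c r f C -> wiener c r' f C.
Proof.
move=> r0 rr [a [aC af]]; exists a; split=> [n|t tr].
  apply: le_trans (aC n); apply: ler_sum => k _.
  by rewrite ler_wpM2l// lerXn2r// nnegrE (le_trans (ltW r0)).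
by apply: af; exact: lt_le_trans rr.
Qed.

Definition analytic_at c f := exists r C, 0 < r /\ wiener c r f C.

(** Convergence at distance [r / 2] bounds the terms of the series there; at radius [r / 4] they are
    dominated by a geometric series of ratio one half. *)
Lemma real_analytic_at (U : set R) f c : real_analytic_on U f -> U c ->
  analytic_at c f.
Proof.
move=> fU /fU [a [r [r0 af]]].
have r20 : 0 < r / 2 by lra.
have : (fun n => \sum_(k < n) a k * (r / 2) ^+ k) @ \oo --> f (c + r / 2).
  have := af (c + r / 2); rewrite addrAC subrr add0r; apply.
  by rewrite gtr0_norm//; lra.
move=> af2.
have : cvgn (series (fun k => a k * (r / 2) ^+ k)).
  apply/cvg_ex; exists (f (c + r / 2)); move: af2; apply: cvg_trans.
  by apply: near_eq_cvg; apply: nearW => n; rewrite /series /= big_mkord.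
move=> /cvg_series_bounded[M [_ Mh]].
have {Mh} aM k : `|a k| * (r / 2) ^+ k <= M + 1.
  have := Mh (M + 1); rewrite ltrDl ltr01 => /(_ isT k I) /=.
  by rewrite normrM [`|(r / 2) ^+ k|]ger0_norm// exprn_ge0// ltW.
exists (r / 4), ((M + 1) / (1 - 2^-1)); split; first by lra.
exists a; split=> [n|t tr]; last by apply: af; lra.
have M0 : 0 <= M + 1 by apply: le_trans (aM 0%N); rewrite expr0 mulr1.
apply: le_trans (_ : \sum_(k < n) (M + 1) * 2^-1 ^+ k <= _).
  apply: ler_sum => k _; have -> : r / 4 = (r / 2) * 2^-1 by field.
  by rewrite exprMn mulrA ler_wpM2r ?aM// exprn_ge0// invr_ge0.
by rewrite -mulr_sumr ler_wpM2l// sum_exprn_le//; lra.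
Qed.

(** Every term left after removing the constant one has positive degree and gains the factor
    [r' / r]. Asking for all smaller radii lets finitely many functions share one. *)
Lemma analytic_small c f e : analytic_at c f -> 0 < e ->
  exists2 r, 0 < r & forall r', 0 < r' -> r' <= r ->
    wiener c r' (fun t => f t - f c) e.
Proof.
move=> [r [C [r0 [a [aC af]]]]] e0.
have C0 : 0 <= C by have := aC 0%N; rewrite big_ord0.
have fc : f c = a 0%N.
  have := af c; rewrite subrr normr0 => /(_ r0) h.
  apply: (cvg_unique (@Rhausdorff R) h).
  apply: cvg_near_cst; exists 1%N => // -[//|n] _ /=.
  rewrite big_ord_recl big1 ?expr0 ?mulr1 ?addr0// => i _.
  by rewrite expr0n mulr0.
(* [C + 1] in place of [C] keeps the radius positive when [C] is zero. *)
pose s := Num.min r (r * (e / (C + 1))).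
have s0 : 0 < s by rewrite lt_min r0 /= mulr_gt0// divr_gt0//; lra.
exists s => // r' r'0 r's.
have r'r : r' <= r by move: r's; rewrite le_min => /andP[].
have r'e : r' / r * C <= e.
  have : r' <= r * (e / (C + 1)) by move: r's; rewrite le_min => /andP[].
  rewrite -ler_pdivrMl// mulrC => h.
  apply: le_trans (_ : e / (C + 1) * C <= e); first by rewrite ler_wpM2r.
  rewrite -mulrA ger_pMr// mulrC ler_pdivrMr; lra.
exists (fun k => if k is 0%N then 0 else a k); split=> [n|t tr].
- apply: le_trans (_ : r' / r * \sum_(k < n) `|a k| * r ^+ k <= _); last first.
    apply: le_trans r'e; rewrite ler_wpM2l// divr_ge0// ltW//.
  rewrite mulr_sumr; apply: ler_sum => -[[|k] /= _] _.
    by rewrite normr0 mul0r expr0 mulr1 !mulr_ge0 ?invr_ge0 ?(ltW r'0) ?(ltW r0).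
  rewrite mulrCA ler_wpM2l// !exprS mulrA divfK ?gt_eqF// ler_wpM2l ?(ltW r'0)//.
  by rewrite lerXn2r// nnegrE ltW.
- have : (fun n => \sum_(k < n) a k * (t - c) ^+ k - f c) @ \oo --> f t - f c.
    by apply: cvgB; [exact/af/(lt_le_trans tr)|exact: cvg_cst].
  apply: cvg_trans; apply: near_eq_cvg.
  exists 1%N => // -[//|n] _ /=; rewrite !big_ord_recl /= fc expr0 !mulr1 add0r.
  by rewrite addrAC subrr add0r.
Qed.

Lemma wiener_analytic_on (U : set R) f : (forall c, U c -> analytic_at c f) ->
  real_analytic_on U f.
Proof.
by move=> h c /h[r [C [r0 [a [_ af]]]]]; exists a, r; split.
Qed.

Lemma analytic_at_cst c (k : R) : analytic_at c (fun=> k).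
Proof. by exists 1, `|k|; split=> //; exact: wiener_cst. Qed.

Lemma analytic_atD c f g : analytic_at c f -> analytic_at c g ->
  analytic_at c (fun t => f t + g t).
Proof.
move=> [r [C [r0 fC]]] [s [D [s0 gD]]].
have m0 : 0 < Num.min r s by rewrite lt_min r0.
exists (Num.min r s), (C + D); split=> //; apply: wienerD => //.
  by apply: wiener_shrink fC => //; rewrite ge_min lexx.
by apply: wiener_shrink gD => //; rewrite ge_min lexx orbT.
Qed.

Lemma analytic_atM c f g : analytic_at c f -> analytic_at c g ->
  analytic_at c (fun t => f t * g t).
Proof.
move=> [r [C [r0 fC]]] [s [D [s0 gD]]].
have m0 : 0 < Num.min r s by rewrite lt_min r0.
exists (Num.min r s), (C * D); split=> //; apply: wienerM => //.
  by apply: wiener_shrink fC => //; rewrite ge_min lexx.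
by apply: wiener_shrink gD => //; rewrite ge_min lexx orbT.
Qed.

Lemma analytic_atV c f : analytic_at c f -> f c != 0 ->
  analytic_at c (fun t => (f t)^-1).
Proof.
move=> fa fc0; have e0 : 0 < `|f c| / 2 by rewrite divr_gt0// normr_gt0.
have [r r0 /(_ r r0 (lexx _)) h] := analytic_small fa e0.
have := wienerZ r0 (f c)^-1 h.
have -> : `|(f c)^-1| * (`|f c| / 2) = 2^-1.
  by rewrite normfV mulrA mulVf ?mul1r// normr_eq0.
move=> /(wiener_inv r0)/(_ _)/wrap[]; first by lra.
move=> /(wienerZ r0 (f c)^-1) w; exists r; eexists; split=> //.
move: w; apply: eq_wiener => t _; rewrite -invfM; congr (_^-1).
by rewrite mulrBr mulVf// addrCA subrr addr0 mulrA divff// mul1r.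
Qed.

Lemma analytic_at_sum c (I : Type) (s : seq I) (F : I -> R -> R) :
  (forall i, analytic_at c (F i)) ->
  analytic_at c (fun t => \sum_(i <- s) F i t).
Proof.
move=> h; elim: s => [|i s ih].
  by under eq_fun do rewrite big_nil; exact: analytic_at_cst.
by under eq_fun do rewrite big_cons; exact: analytic_atD.
Qed.

Lemma analytic_at_prod c (I : Type) (s : seq I) (F : I -> R -> R) :
  (forall i, analytic_at c (F i)) ->
  analytic_at c (fun t => \prod_(i <- s) F i t).
Proof.
move=> h; elim: s => [|i s ih].
  by under eq_fun do rewrite big_nil; exact: analytic_at_cst.
by under eq_fun do rewrite big_cons; exact: analytic_atM.
Qed.

Lemma analytic_continuous c f : analytic_at c f -> {for c, continuous f}.
Proof.
move=> fa; apply/cvgrPdist_le => e e0.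
have [r r0 /(_ r r0 (lexx _)) h] := analytic_small fa e0.
exists r => //= t tr; rewrite distrC.
have tr' : `|t - c| < r by rewrite distrC.
exact: (wiener_bound r0 tr' h).
Qed.

End Shrink.

(** * Contracting projective maps *)

Section Branch.
Variable R : realType.
Implicit Types (c r k L : R) (f s : R -> R).

Definition branch_den (d00 d01 : R -> R) t x := d00 t + d01 t * x.
Definition branch_slope (d00 d01 d10 d11 : R -> R) t x :=
  (d10 t + d11 t * x) / branch_den d00 d01 t x.

(** Slopes are functions of [t] here, because iterating the slope map from a constant produces such
    functions; a real slope is recovered as a constant function. *)
Definition contracting c r k L (sl lg : R -> R -> R) :=
  [/\ forall s, wiener c r s 1 -> wiener c r (fun t => sl t (s t)) 1,
      forall s s' e, wiener c r s 1 -> wiener c r s' 1 ->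
        wiener c r (fun t => s t - s' t) e ->
        wiener c r (fun t => sl t (s t) - sl t (s' t)) (k * e),
      forall s s' e, wiener c r s 1 -> wiener c r s' 1 ->
        wiener c r (fun t => s t - s' t) e ->
        wiener c r (fun t => lg t (s t) - lg t (s' t)) (L * e)
    & forall s, wiener c r s 1 -> wiener c r (fun t => lg t (s t)) L].

Lemma contractingW c r k k' L L' sl lg : k <= k' -> L <= L' ->
  contracting c r k L sl lg -> contracting c r k' L' sl lg.
Proof.
move=> kk LL [h1 h2 h3 h4]; split=> //.
- move=> s s' e s1 s'1 se; apply: wienerW (h2 _ _ _ s1 s'1 se).
  by rewrite ler_wpM2r// (wiener_ge0 se).
- move=> s s' e s1 s'1 se; apply: wienerW (h3 _ _ _ s1 s'1 se).
  by rewrite ler_wpM2r// (wiener_ge0 se).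
- by move=> s s1; apply: wienerW LL (h4 _ s1).
Qed.

(** Divided by [al], the value of [d00] at [c], the denominator becomes [1 + u] with [u] of norm
    below 1, so its inverse and its logarithm are series in [u]. The two inequalities bound the
    image and the derivative of the slope map by norms alone. *)
Lemma branch_contracting (d00 d01 d10 d11 : R -> R) c :
  analytic_at c d00 -> analytic_at c d01 ->
  analytic_at c d10 -> analytic_at c d11 ->
  `|d01 c| + `|d10 c| + `|d11 c| < `|d00 c| ->
  `|d11 c * d00 c| + `|d01 c * d10 c| < (`|d00 c| - `|d01 c|) ^+ 2 ->
  exists k L r, [/\ 0 <= k < 1, 0 <= L, 0 < r & forall r', 0 < r' -> r' <= r ->
    contracting c r' k L (branch_slope d00 d01 d10 d11)
      (fun t x => ln `|branch_den d00 d01 t x|) /\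
    forall t x, `|t - c| < r' -> `|x| <= 1 -> branch_den d00 d01 t x != 0].
Proof.
move=> an00 an01 an10 an11 h1 h2.
pose al := d00 c.
have al0 : al != 0.
  by rewrite -normr_gt0; apply: le_lt_trans h1; rewrite !addr_ge0.
have nal : 0 < `|al| by rewrite normr_gt0.
pose nm (f : R -> R) t := f t * al^-1.
have nmE f : `|nm f c| = `|f c| / `|al| by rewrite /nm normrM normfV.
pose b : R := `|nm d11 c|; pose cc : R := `|nm d10 c|; pose e : R := `|nm d01 c|.
have b0 : 0 <= b := normr_ge0 _. have c0 : 0 <= cc := normr_ge0 _.
have e0 : 0 <= e := normr_ge0 _.
have k1 : e + cc + b < 1.
  by rewrite /e /cc /b !nmE -!mulrDl ltr_pdivrMr// mul1r.
have k2 : b + e * cc < (1 - e) ^+ 2.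
  have hb : `|d11 c| = b * `|al| by rewrite /b nmE divfK// gt_eqF.
  have hc : `|d10 c| = cc * `|al| by rewrite /cc nmE divfK// gt_eqF.
  have he : `|d01 c| = e * `|al| by rewrite /e nmE divfK// gt_eqF.
  move: h2; rewrite !normrM hb hc he -/al.
  have -> : b * `|al| * `|al| + e * `|al| * (cc * `|al|) = (b + e * cc) * `|al| ^+ 2.
    by ring.
  have -> : (`|al| - e * `|al|) ^+ 2 = (1 - e) ^+ 2 * `|al| ^+ 2 by ring.
  by rewrite ltr_pM2r// exprn_gt0.
pose gap := Num.min ((1 - e) ^+ 2 - (b + e * cc)) (1 - (e + cc + b)).
have gap0 : 0 < gap by rewrite lt_min !subr_gt0 k2.
have gap1 : gap <= (1 - e) ^+ 2 - (b + e * cc) by rewrite ge_min lexx.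
have gap2 : gap <= 1 - (e + cc + b) by rewrite ge_min lexx orbT.
(* Size allowed for the variation of each normalized entry. The two inequalities below lose at most
   four and six times [et], so a tenth of the gap leaves room. *)
pose et := gap / 10.
have et0 : 0 < et by rewrite divr_gt0.
have etgap : gap = 10 * et by rewrite /et; field.
(* One [et] is for [nm d00 - 1], and [e + et] bounds [nm d01]. *)
pose q := e + et + et.
have q1 : q < 1 by rewrite /q; lra.
have q0 : 0 <= q by rewrite /q; lra.
have iq0 : 0 < 1 - q by rewrite subr_gt0.
(* Bound for the determinant of the normalized matrix, which is the numerator in a difference of two
   image slopes. *)
pose N := (b + et) * (1 + et) + (e + et) * (cc + et).
have p1 : 0 <= b + et by rewrite addr_ge0// ltW.
have p2 : 0 <= cc + et by rewrite addr_ge0// ltW.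
have p3 : 0 <= e + et by rewrite addr_ge0// ltW.
have p4 : 0 <= 1 + et by rewrite addr_ge0// ltW.
have N0 : 0 <= N by rewrite /N addr_ge0// mulr_ge0.
have N1 : N < (1 - q) ^+ 2.
  have -> : (1 - q) ^+ 2 = (1 - e) ^+ 2 - 4 * et * (1 - e) + 4 * et ^+ 2.
    by rewrite /q; ring.
  have -> : N = b + e * cc + et * (b + 1 + e + cc) + 2 * et ^+ 2.
    by rewrite /N; ring.
  have : et * (b + 1 + e + cc) <= et * 2 by rewrite ler_wpM2l//; lra.
  have : 4 * et * (1 - e) <= 4 * et * 1 by rewrite ler_wpM2l//; lra.
  have : 0 <= et ^+ 2 by rewrite exprn_ge0// ltW.
  lra.
have small f : analytic_at c f -> exists2 r, 0 < r & forall r', 0 < r' -> r' <= r ->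
    wiener c r' (fun t => nm f t - nm f c) et.
  move=> fa; apply: analytic_small et0.
  by apply: analytic_atM fa _; exact: analytic_at_cst.
have [r00 r00p s00] := small _ an00. have [r01 r01p s01] := small _ an01.
have [r10 r10p s10] := small _ an10. have [r11 r11p s11] := small _ an11.
pose r := Num.min (Num.min r00 r01) (Num.min r10 r11).
exists (N / (1 - q) ^+ 2), (`| ln `|al| | + 1 / (1 - q)), r; split.
- apply/andP; split; first by rewrite divr_ge0// exprn_ge0// ltW.
  by rewrite ltr_pdivrMr ?mul1r// exprn_gt0.
- by rewrite addr_ge0// divr_ge0// ltW.
- by rewrite !lt_min r00p r01p r10p r11p.
move=> r' r'0; rewrite !le_min => /andP[/andP[l00 l01] /andP[l10 l11]].
have w00 := s00 _ r'0 l00.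
have w f m : `|nm f c| = m -> wiener c r' (fun t => nm f t - nm f c) et ->
    wiener c r' (nm f) (m + et).
  move=> <- h; apply: eq_wiener (wienerD r'0 (wiener_cst c r' (nm f c)) h) => t _.
  by rewrite addrCA subrr addr0.
have w01 := w _ _ erefl (s01 _ r'0 l01).
have w10 := w _ _ erefl (s10 _ r'0 l10).
have w11 := w _ _ erefl (s11 _ r'0 l11).
have nm00 : nm d00 c = 1 by rewrite /nm divff.
have w00' : wiener c r' (nm d00) (1 + et).
  by apply: w (s00 _ r'0 l00); rewrite nm00 normr1.
rewrite nm00 in w00.
pose u (s : R -> R) t := (nm d00 t - 1) + nm d01 t * s t.
have wu s : wiener c r' s 1 -> wiener c r' (u s) q.
  move=> s1; have -> : q = et + (e + et) * 1 by rewrite /q; ring.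
  by apply: wienerD => //; apply: wienerM.
have denE s t : branch_den d00 d01 t (s t) = al * (1 + u s t).
  rewrite /branch_den /u /nm.
  have -> : 1 + (d00 t / al - 1 + d01 t / al * s t) = (d00 t + d01 t * s t) / al.
    by ring.
  by rewrite mulrCA divff// mulr1.
have u1 s t : wiener c r' s 1 -> `|t - c| < r' -> 0 < 1 + u s t.
  move=> s1 tr; have := wiener_bound r'0 tr (wu _ s1).
  rewrite ler_norml => /andP[h _]; lra.
have slE s t : `|t - c| < r' -> wiener c r' s 1 ->
    branch_slope d00 d01 d10 d11 t (s t) =
    (nm d10 t + nm d11 t * s t) * (1 + u s t)^-1.
  move=> tr s1; rewrite /branch_slope denE invfM /nm.
  by ring.
have lgE s t : `|t - c| < r' -> wiener c r' s 1 ->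
    ln `|branch_den d00 d01 t (s t)| = ln `|al| + ln (1 + u s t).
  move=> tr s1; have n1 := u1 _ _ s1 tr.
  by rewrite denE normrM [`|1 + _|]gtr0_norm// lnM// posrE normr_gt0.
have wln s s' d : wiener c r' s 1 -> wiener c r' s' 1 ->
    wiener c r' (fun t => s t - s' t) d ->
    wiener c r' (fun t => ln (1 + u s t) - ln (1 + u s' t)) (d / (1 - q)).
  move=> s1 s'1 sd; have d0 := wiener_ge0 sd.
  apply: wiener_ln1DB => //; [exact: wu|exact: wu|].
  apply: (@wienerW _ _ _ _ ((e + et) * d)).
    by rewrite ler_piMl//; lra.
  by apply: eq_wiener (wienerM r'0 w01 sd) => t _; rewrite /u; ring.
split; first split.
- move=> s s1.
  have : wiener c r' (fun t => (nm d10 t + nm d11 t * s t) * (1 + u s t)^-1)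
     ((cc + et + (b + et) * 1) * (1 - q)^-1).
    apply: wienerM => //; first by apply: wienerD => //; apply: wienerM.
    by apply: wiener_inv => //; exact: wu.
  move/eq_wiener => /(_ (fun t => branch_slope d00 d01 d10 d11 t (s t))).
  move=> /(_ _)/wrap[t tr|]; first by rewrite slE.
  by apply: wienerW; rewrite ler_pdivrMr// /q; lra.
- move=> s s' d s1 s'1 sd.
  have : wiener c r' (fun t => (nm d11 t * nm d00 t - nm d01 t * nm d10 t) *
      (s t - s' t) * ((1 + u s t)^-1 * (1 + u s' t)^-1))
      (N * d * ((1 - q)^-1 * (1 - q)^-1)).
    apply: wienerM => //; last first.
      by apply: wienerM => //; apply: wiener_inv => //; exact: wu.
    by apply: wienerM => //; apply: wienerB => //; exact: wienerM.
  move/eq_wiener => /(_ (fun t => branch_slope d00 d01 d10 d11 t (s t) -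
     branch_slope d00 d01 d10 d11 t (s' t))).
  move=> /(_ _)/wrap[t tr|].
    have n1 := u1 _ _ s1 tr; have n2 := u1 _ _ s'1 tr.
    rewrite !slE//.
    have e1 : 1 + u s t = nm d00 t + nm d01 t * s t by rewrite /u; ring.
    have e2 : 1 + u s' t = nm d00 t + nm d01 t * s' t by rewrite /u; ring.
    rewrite e1 e2 in n1 n2 *.
    by field; rewrite !gt_eqF.
  apply: wienerW; rewrite -invfM -expr2.
  by rewrite le_eqVlt; apply/orP; left; apply/eqP; ring.
- move=> s s' d s1 s'1 sd.
  have := wln _ _ _ s1 s'1 sd.
  move/eq_wiener => /(_ (fun t => ln `|branch_den d00 d01 t (s t)| -
     ln `|branch_den d00 d01 t (s' t)|)).
  move=> /(_ _)/wrap[t tr|]; first by rewrite !lgE//; ring.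
  apply: wienerW; rewrite [leRHS]mulrDl mul1r mulrC ler_wpDl//.
  by rewrite mulr_ge0// (wiener_ge0 sd).
- move=> s s1.
  have z1 : wiener c r' (fun=> 0) 1.
    by apply: wienerW (wiener_cst c r' 0); rewrite normr0.
  have su : wiener c r' (u s) q := wu _ s1.
  have zu : wiener c r' (fun=> 0) q.
    by apply: wienerW (wiener_cst c r' 0); rewrite normr0.
  have hd : wiener c r' (fun t => u s t - 0) q.
    by apply: eq_wiener su => t _; rewrite subr0.
  have := wienerD r'0 (wiener_cst c r' (ln `|al|)) (wiener_ln1DB r'0 su zu q1 hd).
  move/eq_wiener => /(_ (fun t => ln `|branch_den d00 d01 t (s t)|)).
  move=> /(_ _)/wrap[t tr|]; first by rewrite lgE// addr0 ln1 subr0.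
  by apply: wienerW; rewrite lerD2l ler_wpM2r ?invr_ge0 ?ltW.
- move=> t x tr x1.
  have s1 : wiener c r' (fun=> x) 1 by apply: wienerW (wiener_cst c r' x).
  have := denE (fun=> x) t => ->.
  by rewrite mulf_neq0// gt_eqF// u1.
Qed.

End Branch.

Lemma common_radius (R : realType) (I : finType) (Q : I -> R -> R -> R -> Prop) :
  (forall i k k' L L' r, k <= k' -> L <= L' -> Q i k L r -> Q i k' L' r) ->
  (forall i, exists k L r, [/\ 0 <= k < 1, 0 <= L, 0 < r &
     forall r', 0 < r' -> r' <= r -> Q i k L r']) ->
  exists k L r, [/\ 0 <= k < 1, 0 <= L, 0 < r &
     forall i r', 0 < r' -> r' <= r -> Q i k L r'].
Proof.
move=> Qm h; suff: exists k L r, [/\ 0 <= k < 1, 0 <= L, 0 < r &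
    forall i r', i \in enum I -> 0 < r' -> r' <= r -> Q i k L r'].
  move=> [k [L [r [k1 L0 r0 hh]]]]; exists k, L, r; split=> // i r'.
  by apply: hh; rewrite mem_enum.
elim: (enum I) => [|i s [k [L [r [/andP[k0 k1] L0 r0 ih]]]]].
  by exists 0, 0, 1; split=> //; rewrite lexx ltr01.
have [k' [L' [r2 [/andP[k'0 k'1] L'0 r20 hi]]]] := h i.
exists (Num.max k k'), (Num.max L L'), (Num.min r r2); split.
- by rewrite le_max k0 /= gt_max k1.
- by rewrite le_max L0.
- by rewrite lt_min r0.
move=> j r'; rewrite in_cons le_min => /orP[/eqP ->|js] r'0 /andP[l1 l2].
  by apply: Qm (hi _ r'0 l2); rewrite le_max lexx orbT.
by apply: Qm (ih _ _ js r'0 l1); rewrite le_max lexx.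
Qed.

(** * The Poisson equation of the skew product *)

Section Skew.
Variables (R : realType) (X Y : finType).
Variables (next : Y -> X -> Y) (lst : Y -> X).
Variables (P : R -> X -> X -> R) (D : R -> Y -> X -> 'M[R]_2).
Implicit Types (t s x : R) (y : Y) (a : X).

Definition den t y a x := D t y a 0 0 + D t y a 0 1 * x.
Definition slope t y a x := (D t y a 1 0 + D t y a 1 1 * x) / den t y a x.
Definition logden t y a x := ln `|den t y a x|.
Definition pop t (G : Y -> R -> R) y x :=
  \sum_a P t (lst y) a * G (next y a) (slope t y a x).
Definition meanlog t y x := \sum_a P t (lst y) a * logden t y a x.
(** Subtracting the value at slope 0 before each application of [pop] leaves only the variation in
    the slope, which the contraction shrinks geometrically. The subtracted values depend on the word
    alone and sum to [gsum]; the remainders sum to [corr]. *)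
Fixpoint pit t n : Y -> R -> R :=
  if n is m.+1 then pop t (fun y x => pit t m y x - pit t m y 0) else meanlog t.
Definition gsum t y := limn (fun n => \sum_(k < n) pit t k y 0).
Definition corr t y x := limn (fun n => \sum_(k < n) (pit t k y x - pit t k y 0)).

(** By the triangle inequality, the first clause sends slopes in [-1, 1] strictly inside, and the
    second makes the derivative of the slope map less than 1 in modulus there. *)
Definition cone_strict (M : 'M[R]_2) :=
  `|M 0 1| + `|M 1 0| + `|M 1 1| < `|M 0 0| /\
  `|M 1 1 * M 0 0| + `|M 0 1 * M 1 0| < (`|M 0 0| - `|M 0 1|) ^+ 2.

(** The series of all [pit t1 n y x] is evaluated twice: the recursion gives [meanlog] plus [pop] of
    [corr], and splitting each term at slope 0 gives [gsum + corr]. Hence [meanlog] equals a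
    function of the word up to a coboundary. *)
Lemma skew_poisson t1 :
  (forall y a, cone_strict (D t1 y a)) ->
  (forall y a i j, analytic_at t1 (fun t => D t y a i j)) ->
  (forall i a, analytic_at t1 (fun t => P t i a)) ->
  row_stochastic (P t1) ->
  (forall y, analytic_at t1 (gsum^~ y)) /\
  exists C, forall y a x, `|x| <= 1 ->
    [/\ den t1 y a x != 0, `|slope t1 y a x| <= 1, `|logden t1 y a x| <= C,
        `|corr t1 y x| <= C &
        meanlog t1 y x = gsum t1 y + corr t1 y x - pop t1 (corr t1) y x].
Proof.
move=> cD aD aP [P0 P1].
have br (ya : Y * X) : exists k L r, [/\ 0 <= k < 1, 0 <= L, 0 < r &
    forall r', 0 < r' -> r' <= r ->
      contracting t1 r' k L (fun t => slope t ya.1 ya.2) (fun t => logden t ya.1 ya.2) /\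
      (forall t x, `|t - t1| < r' -> `|x| <= 1 -> den t ya.1 ya.2 x != 0)].
  by have [h1 h2] := cD ya.1 ya.2; exact: branch_contracting.
have mono (i : Y * X) k k' L L' r : k <= k' -> L <= L' ->
   (contracting t1 r k L (fun t => slope t i.1 i.2) (fun t => logden t i.1 i.2) /\
   (forall t x, `|t - t1| < r -> `|x| <= 1 -> den t i.1 i.2 x != 0)) ->
   (contracting t1 r k' L' (fun t => slope t i.1 i.2) (fun t => logden t i.1 i.2) /\
   (forall t x, `|t - t1| < r -> `|x| <= 1 -> den t i.1 i.2 x != 0)).
  by move=> kk LL [h1 h2]; split=> //; apply: contractingW h1.
have [k [L [r0 [/andP[k0 k1] L0 r0p hbr]]]] := common_radius mono br.
pose n1 : R := #|X|.+1%:R.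
have n10 : 0 < n1 by rewrite ltr0n.
(* The errors of the [#|X|] probabilities in a row add up to at most [(1 - k) / 2]; the successor in
   [n1] keeps the divisor positive. *)
pose et := (1 - k) / 2 / n1.
have et0 : 0 < et by rewrite !divr_gt0// subr_gt0.
have brP (ia : X * X) : exists k L r, [/\ (0 : R) <= k < 1, (0 : R) <= L, 0 < r &
    forall r', 0 < r' -> r' <= r ->
      wiener t1 r' (fun t => P t ia.1 ia.2 - P t1 ia.1 ia.2) et].
  have [r r0' h] := analytic_small (aP ia.1 ia.2) et0.
  by exists 0, 0, r; split=> //; rewrite lexx ltr01.
have [_ [_ [r2 [_ _ r2p hP]]]] := @common_radius R _
  (fun ia _ _ r' => wiener t1 r' (fun t => P t ia.1 ia.2 - P t1 ia.1 ia.2) et)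
  (fun _ _ _ _ _ _ _ _ h => h) brP.
pose r := Num.min r0 r2.
have rp : 0 < r by rewrite lt_min r0p.
have rr0 : r <= r0 by rewrite ge_min lexx.
have rr2 : r <= r2 by rewrite ge_min lexx orbT.
have {}hbr y a := hbr (y, a) r rp rr0.
have {}hP i a := hP (i, a) r rp rr2.
(* In Wiener norm a mean with variable weights may exceed 1; [B] bounds it and is close enough to 1
   for the contraction to win, as [B * k <= th < 1]. *)
pose B := 1 + (1 - k) / 2.
have B1 : 1 <= B by rewrite /B; lra.
pose th := (1 + k) / 2.
have th0 : 0 < th by rewrite /th; lra.
have th1 : th < 1 by rewrite /th; lra.
have Bk : B * k <= th.
  have -> : th = B * k + ((1 - k) ^+ 2) / 2 by rewrite /B /th; field.
  by rewrite lerDl divr_ge0// sqr_ge0.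
have wsum y (F : X -> R -> R) M : 0 <= M -> (forall a, wiener t1 r (F a) M) ->
    wiener t1 r (fun t => \sum_a P t (lst y) a * F a t) (B * M).
  move=> M0 FM.
  have := @wiener_sum _ t1 r rp _ (index_enum X) (fun a t => P t (lst y) a * F a t)
    (fun a => (P t1 (lst y) a + et) * M).
  move=> /(_ _)/wrap[a|].
    apply: wienerM => //.
    have := wienerD rp (wiener_cst t1 r (P t1 (lst y) a)) (hP (lst y) a).
    rewrite ger0_norm//; apply: eq_wiener => t _; by rewrite addrCA subrr addr0.
  apply: wienerW; rewrite -mulr_suml ler_wpM2r// big_split /= P1 sumr_const.
  rewrite /B lerD2l -[et *+ _]mulr_natr.
  have -> : (1 - k) / 2 = et * n1 by rewrite /et divfK// gt_eqF.
  by rewrite ler_wpM2l ?(ltW et0)// ler_nat leqnSn.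
have lip n : forall y (s s' : R -> R) e, wiener t1 r s 1 -> wiener t1 r s' 1 ->
    wiener t1 r (fun t => s t - s' t) e ->
    wiener t1 r (fun t => pit t n y (s t) - pit t n y (s' t)) (B * L * th ^+ n * e).
  elim: n => [|n ih] y s s' e s1 s'1 se; have e0 := wiener_ge0 se.
    rewrite expr0 mulr1 -mulrA.
    have := wsum y (fun a t => logden t y a (s t) - logden t y a (s' t)) (L * e).
    rewrite mulr_ge0// => /(_ isT)/(_ _)/wrap[a|].
      by have [[_ _ h _] _] := hbr y a; exact: h.
    apply: eq_wiener => t _; rewrite /= /meanlog -sumrB.
    by apply: eq_bigr => a _; rewrite mulrBr.
  have := wsum y (fun a t => pit t n (next y a) (slope t y a (s t)) -
     pit t n (next y a) (slope t y a (s' t))) (B * L * th ^+ n * (k * e)).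
  rewrite !mulr_ge0 ?exprn_ge0//; try lra.
  move=> /(_ isT)/(_ _)/wrap[a|].
    by have [[h1 h2 _ _] _] := hbr y a; apply: ih; [exact: h1|exact: h1|exact: h2].
  move/eq_wiener => /(_ (fun t => pit t n.+1 y (s t) - pit t n.+1 y (s' t))).
  move=> /(_ _)/wrap[t _|].
    rewrite /= /pop -sumrB; apply: eq_bigr => a _; rewrite -mulrBr.
    by congr (_ * _); ring.
  apply: wienerW; rewrite exprSr.
  have -> : B * (B * L * th ^+ n * (k * e)) = (B * L * th ^+ n * e) * (B * k) by ring.
  have -> : B * L * (th ^+ n * th) * e = (B * L * th ^+ n * e) * th by ring.
  by rewrite ler_wpM2l// !mulr_ge0 ?exprn_ge0//; lra.
have z1 : wiener t1 r (fun=> 0) 1.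
  by apply: wienerW (wiener_cst t1 r 0); rewrite normr0.
have sl1 (s : R -> R) y a : wiener t1 r s 1 -> wiener t1 r (fun t => slope t y a (s t)) 1.
  by have [[h _ _ _] _] := hbr y a; exact: h.
(* The value of [pit n.+1] at slope 0 is a mean of variations of [pit n], hence one more factor [B]
   and a shift of the exponent of [th]. Since [th <= 1 <= B], the case of index 0 is covered too. *)
pose L2 := B * (B * L) / th.
have L20 : 0 <= L2 by rewrite divr_ge0 ?mulr_ge0//; lra.
have pit0 n y : wiener t1 r (fun t => pit t n y 0) (L2 * th ^+ n).
  case: n => [|n].
    have := wsum y (fun a t => logden t y a 0) L L0 => /(_ _)/wrap[a|].
      by have [[_ _ _ h] _] := hbr y a; exact: h z1.
    apply: wienerW; rewrite expr0 mulr1 /L2 ler_pdivlMr// mulrC.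
    apply: ler_pM => //; [lra|by rewrite mulr_ge0//; lra|lra].
  have := wsum y (fun a t => pit t n (next y a) (slope t y a 0) - pit t n (next y a) 0)
     (B * L * th ^+ n * 1).
  rewrite !mulr_ge0 ?exprn_ge0//; try lra.
  move=> /(_ isT)/(_ _)/wrap[a|].
    apply: (lip _ _ (fun t => slope t y a 0) (fun=> 0)) => //; first exact: (sl1 (fun=> 0)).
    by apply: eq_wiener (sl1 (fun=> 0) y a z1) => t _; rewrite subr0.
  apply: wienerW; rewrite /L2 exprS mulr1 mulrA.
  by rewrite -[in leRHS](mulrA (B * (B * L))) (mulrA th^-1) mulVf ?mul1r ?mulrA// gt_eqF.
have geo M n : 0 <= M -> \sum_(i < n) M * th ^+ i <= M / (1 - th).
  by move=> M0; rewrite -mulr_sumr ler_wpM2l// sum_exprn_le// ltW.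
have BL0 : 0 <= B * L by rewrite mulr_ge0//; lra.
have gcv t y : `|t - t1| < r ->
    (fun n => \sum_(i < n) pit t i y 0) @ \oo --> gsum t y.
  move=> tr; apply: (@abs_bounded_series_cvg _ (fun i => pit t i y 0) (L2 / (1 - th))) => n.
  apply: le_trans (geo _ n L20); apply: ler_sum => i _.
  by apply: wiener_bound (pit0 i y).
have cst1 x : `|x| <= 1 -> wiener t1 r (fun=> x) 1.
  by move=> x1; apply: wienerW (wiener_cst t1 r x).
have t11 : `|t1 - t1| < r by rewrite subrr normr0.
have pdiff i y x : `|x| <= 1 -> `|pit t1 i y x - pit t1 i y 0| <= B * L * th ^+ i.
  move=> x1; have := lip i y (fun=> x) (fun=> 0) 1 (cst1 _ x1) z1.
  rewrite mulr1 => /(_ _)/wrap[|h].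
    by apply: eq_wiener (cst1 _ x1) => t _; rewrite subr0.
  exact: (wiener_bound rp t11 h).
have ccv y x : `|x| <= 1 ->
    (fun n => \sum_(i < n) (pit t1 i y x - pit t1 i y 0)) @ \oo --> corr t1 y x.
  move=> x1.
  apply: (@abs_bounded_series_cvg _ (fun i => pit t1 i y x - pit t1 i y 0)
    (B * L / (1 - th))) => n.
  apply: le_trans (geo _ n BL0); apply: ler_sum => i _; exact: pdiff.
split.
  move=> y; exists r, (L2 / (1 - th)); split=> //.
  apply: (@wiener_series _ _ _ rp (fun i t => pit t i y 0) (fun i => L2 * th ^+ i)).
  - by move=> i; exact: pit0.
  - by move=> m; exact: geo.
  - by move=> t tr; exact: gcv.
exists (Num.max L (B * L / (1 - th))) => y a x x1.
have [[hb1 _ _ hb4] hb5] := hbr y a.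
have sle b : `|slope t1 y b x| <= 1.
  exact: (wiener_bound rp t11 (sl1 (fun=> x) y b (cst1 _ x1))).
split.
- exact: hb5.
- exact: sle.
- by rewrite le_max (wiener_bound rp t11 (hb4 (fun=> x) (cst1 _ x1))).
- rewrite le_max; apply/orP; right; apply: cvg_norm_bound (ccv y x x1) _ => n.
  apply: le_trans (geo _ n BL0); apply: le_trans (ler_norm_sum _ _ _) _.
  by apply: ler_sum => i _; exact: pdiff.
- have l1 : (fun n => \sum_(i < n.+1) pit t1 i y x) @ \oo --> gsum t1 y + corr t1 y x.
    have := @cvgn_addn R _ _ 1%N (cvgnD (gcv _ y t11) (ccv y x x1)).
    apply: eq_cvgn => n; rewrite addn1 -big_split; apply: eq_bigr => i _ /=.
    by rewrite addrC subrK.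
  have l2 : (fun n => \sum_(i < n.+1) pit t1 i y x) @ \oo -->
      meanlog t1 y x + pop t1 (corr t1) y x.
    have : (fun n => meanlog t1 y x + \sum_b P t1 (lst y) b *
        \sum_(i < n) (pit t1 i (next y b) (slope t1 y b x) - pit t1 i (next y b) 0)) @ \oo -->
        meanlog t1 y x + pop t1 (corr t1) y x.
      apply: cvgnD; first exact: cvgn_cst.
      by apply: cvg_sumr => b; apply: cvgMl_tmp; exact: ccv.
    apply: eq_cvgn => n; rewrite big_ord_recl /=; congr (_ + _).
    rewrite /pop exchange_big /=; apply: eq_bigr => b _.
    by rewrite mulr_sumr.
  by rewrite (cvg_unique (@Rhausdorff R) l1 l2) addrK.
Qed.

End Skew.

(** * Finite Poisson equation *)

Section MaximumPrinciple.
Variables (R : realFieldType) (X Y : finType) (next : Y -> X -> Y) (lst : Y -> X).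
Variable P : X -> X -> R.
Hypothesis P_ge0 : forall i j, 0 <= P i j.
Hypothesis P_sum1 : forall i, \sum_j P i j = 1.
Variable z0 : Y.
Hypothesis reach : forall y, connect
  (fun y y' => [exists a, (0 < P (lst y) a) && (next y a == y')]) y z0.
Implicit Types h : Y -> R.

Let avg h y := \sum_a P (lst y) a * h (next y a).

Lemma exists_argmax h : exists m, forall y, h y <= h m.
Proof.
by exists [arg max_(m > z0) h m]%O; case: arg_maxP => // m _ hm y; exact: hm.
Qed.

Lemma subharmonic_le h c : (forall y, avg h y = h y + c) -> c <= 0.
Proof.
move=> hc; have [m hm] := exists_argmax h.
have : avg h m <= \sum_a P (lst m) a * h m.
  by apply: ler_sum => a _; rewrite ler_wpM2l.
by rewrite -mulr_suml P_sum1 mul1r hc gerDl.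
Qed.

(** A maximum of a harmonic function propagates along transitions of positive probability, and these
    lead to [z0]. *)
Lemma harmonic_le h y : (forall y, avg h y = h y) -> h y <= h z0.
Proof.
move=> hc; have [m hm] := exists_argmax h.
apply: le_trans (hm y) _.
have step y1 y2 : h y1 = h m ->
    [exists a, (0 < P (lst y1) a) && (next y1 a == y2)] -> h y2 = h m.
  move=> e1 /existsP[a /andP[Pa /eqP <-]].
  have : \sum_a P (lst y1) a * (h m - h (next y1 a)) = 0.
    under eq_bigr do rewrite mulrBr.
    by rewrite sumrB -mulr_suml P_sum1 mul1r -/(avg h y1) hc e1 subrr.
  move/eqP; rewrite psumr_eq0; last by move=> b _; rewrite mulr_ge0 ?subr_ge0.
  move=> /allP/(_ a); rewrite mem_index_enum => /(_ isT) /=.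
  by rewrite mulf_eq0 gt_eqF//= subr_eq0 => /eqP ->.
have [q qm ->] := connectP (reach m).
suff gen y1 : path (fun y y' => [exists a, (0 < P (lst y) a) && (next y a == y')])
    y1 q -> h y1 = h m -> h m <= h (last y1 q) by exact: gen.
elim: q y1 {qm} => [|y2 q ih] y1 /=; first by move=> _ ->.
by move=> /andP[e12 pq] /step/(_ e12)/(ih _ pq).
Qed.

(** Injectivity of [poisson_mx]. The maximum principle for [h] and [- h] first forces the constant
    [h z0] to vanish and then [h] itself. *)
Lemma poisson_kernel h :
  (forall y, h y - avg h y + h z0 = 0) -> forall y, h y = 0.
Proof.
move=> hK; have h1 y : avg h y = h y + h z0 by have := hK y; lra.
have avgN y : avg (fun y => - h y) y = - avg h y.
  by rewrite -sumrN; apply: eq_bigr => a _; rewrite mulrN.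
have hz : h z0 = 0.
  apply/eqP; rewrite eq_le (subharmonic_le h1) /=.
  rewrite -oppr_le0; apply: (@subharmonic_le (fun y => - h y)) => y.
  by rewrite avgN h1 opprD.
have h2 y : avg h y = h y by rewrite h1 hz addr0.
move=> y; apply/eqP; rewrite -hz eq_le harmonic_le//= -lerN2.
by apply: (@harmonic_le (fun y => - h y)) => z; rewrite avgN h2.
Qed.

(** Identity minus transition operator, plus the rank-one map sending [h] to the constant [h z0].
    The unknown constant of the Poisson equation thus becomes the value of the solution at [z0],
    which also fixes the additive freedom and makes the system square. *)
Definition poisson_mx : 'M[R]_#|Y| := \matrix_(i, j)
  ((i == j)%:R - (\sum_a P (lst (enum_val i)) a * (next (enum_val i) a == enum_val j)%:R)
   + (enum_val j == z0)%:R).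

Lemma poisson_mxE h i : (poisson_mx *m \col_j h (enum_val j)) i 0 =
  h (enum_val i) - avg h (enum_val i) + h z0.
Proof.
have pick (F : Y -> R) y : \sum_j (y == enum_val j)%:R * F (enum_val (A := Y) j) = F y.
  rewrite (bigD1 (enum_rank y)) //= enum_rankK eqxx mul1r big1 ?addr0// => j jy.
  case: eqP => [yj|]; last by rewrite mul0r.
  by move: jy; rewrite yj enum_valK eqxx.
rewrite mxE; under eq_bigr do rewrite !mxE 2!mulrDl mulNr.
rewrite !big_split /= sumrN; congr (_ - _ + _).
- rewrite -[RHS](pick h (enum_val i)); apply: eq_bigr => j _.
  by rewrite (inj_eq enum_val_inj).
- rewrite /avg; under eq_bigr do rewrite mulr_suml.
  rewrite exchange_big /=; apply: eq_bigr => a _.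
  under eq_bigr do rewrite -mulrA.
  by rewrite -mulr_sumr pick.
- by rewrite -[RHS](pick h z0); apply: eq_bigr => j _; rewrite eq_sym.
Qed.

Lemma poisson_mx_unit : poisson_mx \in unitmx.
Proof.
rewrite -unitmx_tr -row_free_unit; apply: inj_row_free => v vK.
have Kv : poisson_mx *m v^T = 0 by rewrite -[LHS]trmxK trmx_mul trmxK vK trmx0.
pose h y := v 0 (enum_rank y).
have vh : v^T = \col_j h (enum_val j).
  by apply/matrixP => i j; rewrite !mxE /h enum_valK ord1.
have h0 : forall y, h y = 0.
  apply: poisson_kernel => y; rewrite -(enum_rankK y) -poisson_mxE -vh Kv mxE//.
by apply/rowP => j; rewrite mxE -(h0 (enum_val j)) /h enum_valK.
Qed.

End MaximumPrinciple.

(** * Analytic dependence of the solution on the parameter *)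

Section PoissonAnalytic.
Variables (R : realType) (X Y : finType) (next : Y -> X -> Y) (lst : Y -> X).
Variables (P : R -> X -> X -> R) (z0 : Y) (g : R -> Y -> R).

Lemma analytic_at_det c n (M : R -> 'M[R]_n) :
  (forall i j, analytic_at c (fun t => M t i j)) ->
  analytic_at c (fun t => \det (M t)).
Proof.
move=> h; rewrite /determinant; apply: analytic_at_sum => s.
by apply: analytic_atM; [exact: analytic_at_cst|exact: analytic_at_prod].
Qed.

(** Determinant and adjugate are written out so that analyticity can be read off the formula. *)
Definition poisson_sol t y : R :=
  let K := poisson_mx next lst (P t) z0 in
  ((\det K)^-1 *: (\adj K *m \col_i g t (enum_val i))) (enum_rank y) 0.

Lemma poisson_solP t y : poisson_mx next lst (P t) z0 \in unitmx ->
  poisson_sol t y - \sum_a P t (lst y) a * poisson_sol t (next y a) +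
  poisson_sol t z0 = g t y.
Proof.
move=> Ku; have := poisson_mxE next lst (P t) z0 (poisson_sol t) (enum_rank y).
rewrite enum_rankK => <-.
have -> : \col_j poisson_sol t (enum_val j) =
    (\det (poisson_mx next lst (P t) z0))^-1 *:
    (\adj (poisson_mx next lst (P t) z0) *m \col_i g t (enum_val i)).
  by apply/matrixP => i j; rewrite mxE /poisson_sol enum_valK ord1.
rewrite -scalemxAr mulmxA mul_mx_adj mul_scalar_mx scalerA mulVf ?scale1r.
  by rewrite mxE enum_rankK.
by move: Ku; rewrite unitmxE unitfE.
Qed.

Lemma poisson_sol_analytic c y : (forall i a, analytic_at c (fun t => P t i a)) ->
  (forall y, analytic_at c (g^~ y)) ->
  poisson_mx next lst (P c) z0 \in unitmx ->
  analytic_at c (poisson_sol^~ y).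
Proof.
move=> aP ag Ku.
have aK i j : analytic_at c (fun t => poisson_mx next lst (P t) z0 i j).
  under eq_fun do rewrite mxE.
  apply: analytic_atD; last exact: analytic_at_cst.
  apply: analytic_atD; first exact: analytic_at_cst.
  under eq_fun do rewrite -mulN1r.
  apply: analytic_atM; first exact: analytic_at_cst.
  apply: analytic_at_sum => a; apply: analytic_atM => //.
  exact: analytic_at_cst.
rewrite /poisson_sol; under eq_fun do rewrite mxE mxE.
apply: analytic_atM.
  apply: analytic_atV; first exact: analytic_at_det.
  by move: Ku; rewrite unitmxE unitfE.
apply: analytic_at_sum => i; apply: analytic_atM; last first.
  by under eq_fun do rewrite mxE; exact: ag.
under eq_fun do rewrite mxE /cofactor.
apply: analytic_atM; first exact: analytic_at_cst.
apply: analytic_at_det => k l; have := aK (lift i k) (lift (enum_rank y) l).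
by congr analytic_at; apply/funext => t; rewrite [RHS]mxE [RHS]mxE.
Qed.

End PoissonAnalytic.

(** * Strong law for martingale differences of a Markov process *)

Section Expectation.
Variables (R : realType) (X : finType) (P : X -> X -> R) (p : X -> R).
Variable (w : nat -> X).
Hypotheses (p_ge0 : forall i, 0 <= p i) (p_sum1 : \sum_i p i = 1).
Hypotheses (P_ge0 : forall i j, 0 <= P i j) (P_sum1 : forall i, \sum_j P i j = 1).
Implicit Types (F G A B : (nat -> X) -> R) (x y : nat -> X).

Definition upd x k (a : X) : nat -> X := fun i => if i == k then a else x i.

Definition depends_upto T m (F : (nat -> X) -> T) :=
  forall x y, (forall k, (k <= m)%N -> x k = y k) -> F x = F y.

(** Expectation of [F] under the Markov measure, computed on the first [m + 1] letters; [w] only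
    fills the later coordinates. Each unfolding is a conditional expectation given the earlier
    letters. *)
Fixpoint path_mean m F : R :=
  if m is m'.+1 then
    path_mean m' (fun x => \sum_a P (x m') a * F (upd x m'.+1 a))
  else \sum_a p a * F (upd w 0 a).

Lemma path_mean_le m F G : (forall x, F x <= G x) -> path_mean m F <= path_mean m G.
Proof.
elim: m F G => [|m ih] F G FG /=.
  by apply: ler_sum => a _; rewrite ler_wpM2l.
by apply: ih => x; apply: ler_sum => a _; rewrite ler_wpM2l.
Qed.

Lemma path_meanD m F G :
  path_mean m (fun x => F x + G x) = path_mean m F + path_mean m G.
Proof.
elim: m F G => [|m ih] F G /=.
  by rewrite -big_split; apply: eq_bigr => a _ /=; rewrite mulrDr.
rewrite -ih; congr path_mean; apply/funext => x.
by rewrite -big_split; apply: eq_bigr => a _ /=; rewrite mulrDr.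
Qed.

Lemma path_meanZ m (c : R) F : path_mean m (fun x => c * F x) = c * path_mean m F.
Proof.
elim: m F => [|m ih] F /=.
  by rewrite mulr_sumr; apply: eq_bigr => a _; rewrite mulrCA.
rewrite -ih; congr path_mean; apply/funext => x.
by rewrite mulr_sumr; apply: eq_bigr => a _; rewrite mulrCA.
Qed.

Lemma path_mean_cst m (c : R) : path_mean m (fun=> c) = c.
Proof.
elim: m => [|m ih] /=; first by rewrite -mulr_suml p_sum1 mul1r.
rewrite -[RHS]ih; congr path_mean; apply/funext => x.
by rewrite -mulr_suml P_sum1 mul1r.
Qed.

Lemma depends_upd T m (F : (nat -> X) -> T) x a : depends_upto m F ->
  F (upd x m.+1 a) = F x.
Proof. by apply=> k km; rewrite /upd ltn_eqF. Qed.

(** The factor [B] is known at time [m] and [psi] has conditional mean zero, so their product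
    disappears from the expectation. *)
Lemma path_mean_step m A B psi F :
  depends_upto m A -> depends_upto m B ->
  (forall x, \sum_a P (x m) a * psi (upd x m.+1 a) = 0) ->
  (forall x, F x <= A x + B x * psi x) ->
  path_mean m.+1 F <= path_mean m A.
Proof.
move=> mA mB psi0 FAB; apply: le_trans (path_mean_le _ FAB) _ => /=.
rewrite le_eqVlt; apply/orP; left; apply/eqP; congr path_mean; apply/funext => x.
under eq_bigr do rewrite (depends_upd _ _ mA) (depends_upd _ _ mB) mulrDr mulrCA.
by rewrite big_split /= -mulr_suml -mulr_sumr psi0 mulr0 addr0 P_sum1 mul1r.
Qed.

Section Moments.
Variables (l : nat) (psi : nat -> (nat -> X) -> R) (C : R).
Hypothesis psi_dep : forall j, depends_upto (j + l).+1 (psi j).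
Hypothesis psi_mean : forall j x,
  \sum_a P (x (j + l)%N) a * psi j (upd x (j + l).+1 a) = 0.
Hypothesis psi_bound : forall j x, `|psi j x| <= C.

Let S n x := \sum_(j < n) psi j x.

Lemma mart_sum_dep n : depends_upto (n + l) (S n).
Proof.
move=> x y xy; apply: eq_bigr => j _; apply: psi_dep => k kj; apply: xy.
by apply: leq_trans kj _; rewrite -addSn leq_add2r.
Qed.

Let SSr n x : S n.+1 x = S n x + psi n x.
Proof. by rewrite /S big_ord_recr. Qed.

Let psi2 j x : psi j x ^+ 2 <= C ^+ 2.
Proof.
by rewrite -[psi j x ^+ 2]real_normK ?num_real// lerXn2r// ?nnegrE//
  (le_trans _ (psi_bound j x)).
Qed.

Lemma second_moment n : path_mean (n + l) (fun x => S n x ^+ 2) <= C ^+ 2 * n%:R.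
Proof.
elim: n => [|n ih].
  rewrite mulr0 -(path_mean_cst l 0) add0n; apply: path_mean_le => x.
  by rewrite /S big_ord0 expr0n.
apply: le_trans (_ : path_mean (n + l) (fun x => S n x ^+ 2 + C ^+ 2) <= _).
  apply: (@path_mean_step _ _ (fun x => 2 * S n x) (psi n)) => //.
  - by move=> x y xy; rewrite (mart_sum_dep xy).
  - by move=> x y xy; rewrite (mart_sum_dep xy).
  - move=> x; rewrite SSr.
    have -> : (S n x + psi n x) ^+ 2 = S n x ^+ 2 + 2 * S n x * psi n x + psi n x ^+ 2.
      by ring.
    by have := psi2 n x; lra.
by rewrite path_meanD path_mean_cst -natr1 mulrDr mulr1 lerD2r.
Qed.

(** Second moments would give tail probabilities of order [1 / n], which are not summable; fourth
    moments of order [n ^ 2] give the order [n ^ -2]. *)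
Lemma fourth_moment n :
  path_mean (n + l) (fun x => S n x ^+ 4) <= 4 * C ^+ 4 * n%:R ^+ 2.
Proof.
elim: n => [|n ih].
  rewrite expr0n mulr0 -(path_mean_cst l 0) add0n; apply: path_mean_le => x.
  by rewrite /S big_ord0 expr0n.
apply: le_trans (_ : path_mean (n + l)
    (fun x => S n x ^+ 4 + (8 * C ^+ 2 * S n x ^+ 2 + 3 * C ^+ 4)) <= _).
  apply: (@path_mean_step _ _ (fun x => 4 * S n x ^+ 3) (psi n)) => //.
  - by move=> x y xy; rewrite (mart_sum_dep xy).
  - by move=> x y xy; rewrite (mart_sum_dep xy).
  - move=> x; rewrite SSr; set s := S n x; set q := psi n x.
    have q2 : q ^+ 2 <= C ^+ 2 by exact: psi2.
    have q4 : q ^+ 4 <= C ^+ 4.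
      by rewrite !(exprM _ 2 2) lerXn2r// nnegrE ?sqr_ge0.
    have -> : (s + q) ^+ 4 = s ^+ 4 + 4 * s ^+ 3 * q + 6 * (s ^+ 2 * q ^+ 2) +
       4 * (s * q ^+ 3) + q ^+ 4 by ring.
    have h1 : s ^+ 2 * q ^+ 2 <= s ^+ 2 * C ^+ 2 by rewrite ler_wpM2l ?sqr_ge0.
    (* This square yields [4 s q^3 <= 2 s^2 q^2 + 2 q^4], whence the coefficients 8 = 6 + 2 and 3 =
       1 + 2 of the majorant. *)
    have h2 : 0 <= (s * q - q ^+ 2) ^+ 2 by rewrite sqr_ge0.
    have h3 : (s * q - q ^+ 2) ^+ 2 = s ^+ 2 * q ^+ 2 - 2 * (s * q ^+ 3) + q ^+ 4.
      by ring.
    move: h1 h2 q4; rewrite h3 -[8 * C ^+ 2 * s ^+ 2]mulrA (mulrC (C ^+ 2)); lra.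
rewrite path_meanD path_meanD path_meanZ path_mean_cst.
have C2 : 0 <= C ^+ 2 by rewrite sqr_ge0.
have h : 8 * C ^+ 2 * path_mean (n + l) (fun x => S n x ^+ 2) <=
    8 * C ^+ 2 * (C ^+ 2 * n%:R).
  by rewrite ler_wpM2l ?second_moment// mulr_ge0.
have C4 : 0 <= C ^+ 4 by rewrite (exprM _ 2 2) sqr_ge0.
have -> : 4 * C ^+ 4 * n.+1%:R ^+ 2 = 4 * C ^+ 4 * n%:R ^+ 2 +
   8 * C ^+ 2 * (C ^+ 2 * n%:R) + 4 * C ^+ 4 by rewrite -natr1; ring.
by move: ih h; lra.
Qed.

End Moments.

(** * From nested sums to the law of the process *)

Section Law.
Context d (T : measurableType d) (mu : probability T R) (xi : T -> nat -> X).
Hypothesis xi_law : forall (u : nat -> X) (n : nat),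
  measurable (xi @^-1` cylinder u n) /\
  mu (xi @^-1` cylinder u n) = (p (u 0%N) * \prod_(k < n) P (u k) (u k.+1))%:E.

Lemma depends_upto_measurable m (B : set (nat -> X)) : depends_upto m B ->
  measurable (xi @^-1` B).
Proof.
move=> mB.
pose ext (f : {ffun 'I_m.+1 -> X}) k := f (inord k).
have -> : xi @^-1` B = \bigcup_(f in [set f | B (ext f)]) (xi @^-1` cylinder (ext f) m).
  apply/seteqP; split => [t Bt|t [f /= Bf ft]].
    have e k : (k <= m)%N -> xi t k = ext [ffun i => xi t (nat_of_ord i)] k.
      by move=> km; rewrite /ext ffunE inordK.
    by exists [ffun i => xi t (nat_of_ord i)] => //=; rewrite -(mB _ _ e).
  by rewrite /preimage /= (mB _ _ ft).
apply: fin_bigcup_measurable; first exact: finite_finset.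
by move=> f _; case: (xi_law (ext f) m).
Qed.

Local Open Scope ereal_scope.

(** The recursion of [path_mean] without weights: a sum over words, arranged so that weighting the
    summand by cylinder masses gives back [path_mean]. *)
Fixpoint word_sum m (F : (nat -> X) -> \bar R) : \bar R :=
  if m is m'.+1 then word_sum m' (fun x => \sum_a F (upd x m'.+1 a))
  else \sum_a F (upd w 0%N a).

Lemma word_sum_le m (F G : (nat -> X) -> \bar R) :
  (forall x, F x <= G x) -> word_sum m F <= word_sum m G.
Proof.
elim: m F G => [|m ih] F G FG /=; first by apply: lee_sum.
by apply: ih => x; apply: lee_sum.
Qed.

Lemma word_sum_mean m F : word_sum m
  (fun x => (p (x 0%N) * \prod_(k < m) P (x k) (x k.+1) * F x)%:E) =
  (path_mean m F)%:E.
Proof.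
elim: m F => [|m ih] F /=.
  by rewrite -sumEFin; apply: eq_bigr => a _; rewrite big_ord0 mulr1 /upd eqxx.
rewrite -ih; congr word_sum; apply/funext => x; rewrite sumEFin; congr EFin.
rewrite mulr_sumr; apply: eq_bigr => a _.
rewrite mulrA; congr (_ * _)%R; rewrite big_ord_recr /= mulrA.
rewrite {1}/upd /=; congr (_ * _ * _)%R; last by rewrite /upd eqxx ltn_eqF.
by apply: eq_bigr => k _; rewrite /upd !ltn_eqF// ltnS// ltnW.
Qed.

(** Only upper bounds of probabilities are wanted, for null sets and for Borel-Cantelli, so
    splitting the event along cylinders and using subadditivity is enough. *)
Lemma measure_path_mean m (B : set (nat -> X)) : depends_upto m B ->
  mu (xi @^-1` B) <= (path_mean m \1_B)%:E.
Proof.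
move=> mB.
have meas x k : measurable (xi @^-1` (B `&` cylinder x k)).
  apply: measurableI; first exact: depends_upto_measurable mB.
  by case: (xi_law x k).
have split_le (A : set (nat -> X)) k (V : X -> set (nat -> X)) :
    measurable (xi @^-1` A) -> (forall a, measurable (xi @^-1` V a)) ->
    (forall y, A y -> V (y k) y) ->
    mu (xi @^-1` A) <= \sum_a mu (xi @^-1` V a).
  move=> mA mV AV.
  have := @content_sub_fsum _ _ _ mu X [set` enum X] (xi @^-1` A)
    (fun a => xi @^-1` V a).
  rewrite -fsbig_seq ?enum_uniq//= big_enum /=; apply => //.
  by move=> t At; exists (xi t k); [rewrite /= mem_enum|exact: AV].
have claim : mu (xi @^-1` B) <= word_sum m (fun x => mu (xi @^-1` (B `&` cylinder x m))).
  have : forall k, mu (xi @^-1` B) <=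
      word_sum k (fun x => mu (xi @^-1` (B `&` cylinder x k))).
    elim=> [|k ih] /=.
      apply: (split_le B 0%N (fun a => B `&` cylinder (upd w 0%N a) 0%N)) => //.
        exact: depends_upto_measurable mB.
      by move=> y By; split=> // -[|//] _; rewrite /upd eqxx.
    apply: le_trans ih _; apply: word_sum_le => x.
    apply: (split_le _ k.+1 (fun a => B `&` cylinder (upd x k.+1 a) k.+1)) => //.
    move=> y [By yx]; split=> // i; rewrite leq_eqVlt /upd => /orP[/eqP ->|ik].
      by rewrite eqxx.
    by rewrite ltn_eqF// yx.
  exact.
apply: le_trans claim _; rewrite -word_sum_mean; apply: word_sum_le => x.
have [Bx|nBx] := pselect (B x).
  rewrite indicE mem_set// mulr1 -(xi_law x m).2 le_measure ?inE//.
    by case: (xi_law x m).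
  by move=> t [].
rewrite (_ : _ @^-1` _ = set0) ?measure0 ?indicE ?memNset ?mulr0//.
rewrite -subset0 => t [Bt xt]; apply: nBx.
by rewrite -(mB (xi t)).
Qed.

Local Close Scope ereal_scope.

Lemma ae_admissible : {ae mu, forall om, forall n, 0 < P (xi om n) (xi om n.+1)}.
Proof.
apply/ae_foralln => n.
pose B := [set x : nat -> X | ~ 0 < P (x n) (x n.+1)].
have mB : depends_upto n.+1 B by move=> x y xy; rewrite /B /= !xy.
exists (xi @^-1` B); split; [exact: depends_upto_measurable mB| |by []].
apply/eqP; rewrite eq_le measure_ge0 andbT.
apply: le_trans (measure_path_mean mB) _; rewrite lee_fin /=.
rewrite -[leRHS](path_mean_cst n 0); apply: path_mean_le => x.
rewrite big1// => a _; rewrite indicE.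
have [Pa|Pa] := ltP 0 (P (x n) a).
  by rewrite memNset ?mulr0// /B /= /upd eqxx ltn_eqF//; apply.
suff -> : P (x n) a = 0 by rewrite mul0r.
by apply/eqP; rewrite eq_le Pa P_ge0.
Qed.

(** Comparison with a telescoping sum: [q ^- 2 <= 2 / (q * (q + 1))] for [q >= 1]. *)
Lemma sum_inv_sqr_le n : \sum_(0 <= k < n) (k.+1%:R ^- 2 : R) <= 2.
Proof.
apply: le_trans (_ : \sum_(0 <= k < n) (- 2 * k.+2%:R^-1 - - 2 * k.+1%:R^-1) <= _).
  apply: ler_sum => k _; set q : R := k.+1%:R.
  have q1 : 1 <= q by rewrite ler1n.
  have -> : k.+2%:R = q + 1 by rewrite /q natr1.
  have -> : - 2 * (q + 1)^-1 - - 2 * q^-1 = 2 / (q * (q + 1)).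
    by field; rewrite !gt_eqF//; lra.
  rewrite ler_pdivlMr ?mulr_gt0//; try lra.
  have -> : q ^- 2 * (q * (q + 1)) = 1 + q^-1 by field; rewrite gt_eqF//; lra.
  by rewrite -[leRHS]/(1 + 1) lerD2l invf_le1//; lra.
rewrite (telescope_sumr (fun k => - 2 * k.+1%:R^-1))// invr1.
have : 0 <= n.+1%:R^-1 :> R by rewrite invr_ge0.
by move: (n.+1%:R^-1) => z z0; lra.
Qed.

Section StrongLaw.
Variables (l : nat) (psi : nat -> (nat -> X) -> R) (C : R).
Hypothesis psi_dep : forall j, depends_upto (j + l).+1 (psi j).
Hypothesis psi_mean : forall j x,
  \sum_a P (x (j + l)%N) a * psi j (upd x (j + l).+1 a) = 0.
Hypothesis psi_bound : forall j x, `|psi j x| <= C.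

Let S n x := \sum_(j < n) psi j x.

(** Markov's inequality applied to the fourth power of the sum. *)
Lemma measure_large_sum (e : R) (n : nat) : 0 < e ->
  (mu (xi @^-1` [set x | (e * n.+1%:R <= `|S n.+1 x|)%R]) <=
  (4 * C ^+ 4 / e ^+ 4 * n.+1%:R ^- 2)%:E)%E.
Proof.
move=> e0; set B := [set x | _].
have mB : depends_upto (n.+1 + l) B.
  by move=> x y xy; rewrite /B /= /S (mart_sum_dep psi_dep xy).
apply: le_trans (measure_path_mean mB) _; rewrite lee_fin.
have n0 : 0 < n.+1%:R :> R by rewrite ltr0n.
have en0 : 0 < e * n.+1%:R by rewrite mulr_gt0.
apply: le_trans (_ : path_mean (n.+1 + l)
   (fun x => (e * n.+1%:R) ^- 4 * S n.+1 x ^+ 4) <= _).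
  apply: path_mean_le => x; rewrite indicE.
  have S4 : S n.+1 x ^+ 4 = `|S n.+1 x| ^+ 4.
    by rewrite !(exprM _ 2 2) real_normK ?num_real.
  have [Bx|nBx] := pselect (B x); last first.
    rewrite memNset//= mulr_ge0 ?S4 ?exprn_ge0//.
    by rewrite invr_ge0 exprn_ge0// ltW.
  rewrite mem_set//= mulrC ler_pdivlMr ?exprn_gt0// mul1r S4.
  by rewrite lerXn2r// ?nnegrE// ltW.
rewrite path_meanZ.
apply: le_trans (_ : (e * n.+1%:R) ^- 4 * (4 * C ^+ 4 * n.+1%:R ^+ 2) <= _).
  rewrite ler_wpM2l ?invr_ge0 ?exprn_ge0 ?(ltW en0)//.
  exact: (fourth_moment psi_dep psi_mean psi_bound).
rewrite le_eqVlt; apply/orP; left; apply/eqP.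
by field; rewrite !gt_eqF.
Qed.

(** Borel-Cantelli is applied once for each threshold [1 / (k + 1)]; the countable union of the
    exceptional sets is still negligible. *)
Lemma mart_slln :
  {ae mu, forall om, (fun n => n%:R^-1 * S n (xi om)) @ \oo --> 0}.
Proof.
pose F k n := xi @^-1` [set x | k.+1%:R^-1 * n.+1%:R <= `|S n.+1 x|].
have mF k n : measurable (F k n).
  apply: (@depends_upto_measurable (n.+1 + l)).
  by move=> x y xy; rewrite /= /S (mart_sum_dep psi_dep xy).
have F0 k : mu (lim_sup_set (F k)) = 0%E.
  apply: lim_sup_set_cvg0 => //.
  pose K : R := 4 * C ^+ 4 / k.+1%:R^-1 ^+ 4.
  have K0 : 0 <= K.
    apply: divr_ge0; last by rewrite exprn_ge0 ?invr_ge0.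
    by apply: mulr_ge0 => //; exact: exprn_even_ge0.
  apply: le_lt_trans (ltry (K * 2)); apply: lime_le.
    by apply: is_cvg_nneseries => n _ _; exact: measure_ge0.
  apply: nearW => n.
  apply: le_trans (_ : (\sum_(0 <= i < n) (K * i.+1%:R ^- 2)%:E <= _)%E).
    by apply: lee_sum => i _; apply: measure_large_sum; rewrite invr_gt0.
  by rewrite sumEFin lee_fin -mulr_sumr ler_wpM2l// sum_inv_sqr_le.
have negl : mu.-negligible (\bigcup_k lim_sup_set (F k)).
  apply: negligible_bigcup => k; exists (lim_sup_set (F k)); split; [|exact: F0|by []].
  by apply: bigcap_measurable => // n _; apply: bigcup_measurable.
apply: negligibleS negl => om /= ncv; apply: contrapT => nU; apply: ncv.
apply/cvgrPdist_lt => e e0.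
have [k ke] : exists k, k.+1%:R^-1 < e.
  have /= [k _ /(_ k (leqnn k))] := near_infty_natSinv_lt (PosNum e0).
  by exists k.
have : ~ lim_sup_set (F k) om by move=> h; apply: nU; exists k.
move=> /existsNP[m /not_implyP[_ nU']].
have h j : (m <= j)%N -> ~ F k j om by move=> mj Fj; apply: nU'; exists j.
exists m.+1 => // -[//|n] mn; rewrite sub0r normrN normrM ger0_norm ?invr_ge0//.
apply: lt_trans ke; rewrite mulrC ltr_pdivrMr ?ltr0n//.
by rewrite ltNge; apply/negP => hn; exact: (h n mn hn).
Qed.

End StrongLaw.
End Law.
End Expectation.

(** * Compactness of the two-sided shift; planar linear algebra *)

Section Compactness.
Variables (X : finType) (E : rel X).
Implicit Types (x y z : int -> X) (N : nat).

Definition window_set x N : set (int -> X) :=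
  [set y | two_sided_shift E y /\ forall k : int, `|k| <= N%:Z -> y k = x k].

Lemma window_setS x M N : (M <= N)%N -> window_set x N `<=` window_set x M.
Proof.
by move=> MN y [Sy yx]; split=> // k kM; apply: yx; apply: le_trans kM _; rewrite lez_nat.
Qed.

Lemma ultra_finite_value (T : Type) (F : set_system T) (f : T -> X) :
  UltraFilter F -> exists v, F [set t | f t = v].
Proof.
move=> FU; apply: contrapT => /forallNP nF.
have {}nF v : F [set t | f t <> v].
  by have [/nF|] := in_ultra_setVsetC [set t | f t = v] FU.
have : F [set t | forall v, v \in enum X -> f t <> v].
  elim: (enum X) => [|v s ih]; first by apply: filterS filterT.
  apply: filterS2 (nF v) ih => t tv ts u; rewrite in_cons => /orP[/eqP ->//|].
  exact: ts.
by move=> /filter_ex[t /(_ (f t))]; rewrite mem_enum; apply.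
Qed.

(** Otherwise some path fails at every radius. Along an ultrafilter of radii each coordinate of
    these paths is eventually constant, since it takes finitely many values; the limit path is
    admissible and contradicts the local hypothesis. *)
Lemma two_sided_shift_compact (Q : set (int -> X) -> Prop) :
  (forall B C, B `<=` C -> Q C -> Q B) ->
  (forall x, two_sided_shift E x -> exists N, Q (window_set x N)) ->
  exists N, forall x, two_sided_shift E x -> Q (window_set x N).
Proof.
move=> QS Qloc; apply: contrapT => /forallNP nQ.
have {}nQ N : exists x, two_sided_shift E x /\ ~ Q (window_set x N).
  by have /existsNP[x /not_implyP h] := nQ N; exists x.
have [xs xsP] := choice nQ.
have [G [GU Goo]] := ultraFilterLemma (eventually_filter : ProperFilter \oo).
have [x xG] := choice (fun k : int => ultra_finite_value (fun M => xs M k) GU).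
have Sx : two_sided_shift E x.
  move=> n; have [M [/= <- <-]] := filter_ex (filterI (xG n) (xG (n + 1))).
  exact: (xsP M).1.
have [N QN] := Qloc x Sx.
have GN : G [set M | forall k : int, `|k| <= N%:Z -> xs M k = x k].
  have : G [set M | forall k : nat, (k <= N)%N -> xs M k%:Z = x k%:Z /\
      xs M (- k%:Z) = x (- k%:Z)].
    elim: {QN} N => [|N ih].
      by apply: filterS (xG 0) => M xM k; rewrite leqn0 => /eqP ->.
    apply: filterS2 ih (filterI (xG N.+1%:Z) (xG (- N.+1%:Z))) => M h [h1 h2] k.
    by rewrite leq_eqVlt => /orP[/eqP ->//|]; rewrite ltnS; exact: h.
  apply: filterS => M h [k|k] kN.
    by have [] := h k _; rewrite // -lez_nat.
  by have [] := h k.+1 _; rewrite // -lez_nat.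
have [M [NM xM]] : exists M, (N <= M)%N /\ window_set x N (xs M).
  have [M [/= h1 h2]] := filter_ex (filterI (Goo _ (nbhs_infty_ge N)) GN).
  by exists M; split=> //; split=> //; exact: (xsP M).1.
apply: (xsP M).2; apply: QS QN => y [Sy yM]; split=> // k kN.
rewrite yM; first by case: xM => _; apply.
by apply: le_trans kN _; rewrite lez_nat.
Qed.

(** The neighbourhoods of [x] in the product topology, restricted to the shift; continuity of a line
    field becomes convergence along this filter. *)
Definition window_filter x : set_system (int -> X) :=
  filter_from [set: nat] (window_set x).

Global Instance window_filter_filter x : Filter (window_filter x).
Proof.
apply: filter_from_filter; first by exists 0%N.
move=> M N _ _; exists (maxn M N) => // y h.
by split; [exact: window_setS (leq_maxl M N) _ h|exact: window_setS (leq_maxr M N) _ h].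
Qed.

Lemma two_sided_shift_shift x : two_sided_shift E x -> two_sided_shift E (shift2 x).
Proof. by move=> Sx n; exact: Sx. Qed.

Lemma window_set_shift x y N : window_set x N.+1 y ->
  window_set (shift2 x) N (shift2 y).
Proof.
move=> [Sy yx]; split; first exact: two_sided_shift_shift.
move=> k kN; apply: yx; apply: le_trans (ler_normD _ _) _.
by rewrite normr1 intS addrC lerD2l.
Qed.

End Compactness.

(** * Bases, slopes and projections in the plane *)

Section Planar.
Variable R : realType.
Implicit Types (u v w d e : 'cV[R]_2) (M : 'M[R]_2) (k m s : R).

Definition det2 u v : R := u 0 0 * v 1 0 - u 1 0 * v 0 0.

Lemma sum2E (F : 'I_2 -> R) : \sum_(i < 2) F i = F 0 + F 1.
Proof.
rewrite !big_ord_recl big_ord0 addr0; congr (F _ + F _); exact/val_inj.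
Qed.

Lemma cV2P u v : u 0 0 = v 0 0 -> u 1 0 = v 1 0 -> u = v.
Proof.
move=> h0 h1; apply/colP => -[[|[|//]] i].
  by have -> : Ordinal i = 0 by exact/val_inj.
by have -> : Ordinal i = 1 by exact/val_inj.
Qed.

Lemma mulmx2E M v i : (M *m v) i 0 = M i 0 * v 0 0 + M i 1 * v 1 0.
Proof. by rewrite mxE sum2E. Qed.

Lemma enormE v : enorm v = Num.sqrt (v 0 0 ^+ 2 + v 1 0 ^+ 2).
Proof. by rewrite /enorm sum2E. Qed.

Lemma enorm_ge0 v : 0 <= enorm v.
Proof. exact: sqrtr_ge0. Qed.

Lemma enorm_sqr v : enorm v ^+ 2 = v 0 0 ^+ 2 + v 1 0 ^+ 2.
Proof. by rewrite enormE sqr_sqrtr// addr_ge0// sqr_ge0. Qed.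

Lemma enormZ k v : enorm (k *: v) = `|k| * enorm v.
Proof. by rewrite !enormE !mxE !exprMn -mulrDr sqrtrM ?sqr_ge0// sqrtr_sqr. Qed.

Lemma enorm_eq0 v : enorm v = 0 -> v = 0.
Proof.
move=> v0; have : v 0 0 ^+ 2 + v 1 0 ^+ 2 == 0 by rewrite -enorm_sqr v0 expr0n.
rewrite paddr_eq0 ?sqr_ge0// !sqrf_eq0 => /andP[/eqP h0 /eqP h1].
by apply: cV2P; rewrite !mxE.
Qed.

Lemma enorm_gt0 v : v != 0 -> 0 < enorm v.
Proof.
move=> v0; rewrite lt_neqAle enorm_ge0 andbT eq_sym.
by apply: contra_neq v0; exact: enorm_eq0.
Qed.

Lemma unitmx_mul_neq0 M v : M \in unitmx -> v != 0 -> M *m v != 0.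
Proof. by move=> Mu; apply: contra_neq => Mv; rewrite -(mulKmx Mu v) Mv mulmx0. Qed.

Lemma det2_neq0 u v : det2 u v != 0 -> u != 0 /\ v != 0.
Proof.
by split; apply/eqP => z0; move: H; rewrite z0 /det2 !mxE ?mul0r ?mulr0 subrr eqxx.
Qed.

Lemma cramer2 d e v : det2 d e != 0 ->
  v = (det2 v e / det2 d e) *: d + (det2 d v / det2 d e) *: e.
Proof.
by move=> de0; apply: cV2P; rewrite !mxE; move: de0; rewrite /det2 => de0; field.
Qed.

(* The matrix of M in the bases (d, e) of the source and (d', e') of the target. *)
Definition trans_mx M d e d' e' : 'M[R]_2 := \matrix_(i, j)
  ((if i == 0 then det2 (M *m (if j == 0 then d else e)) e'
    else det2 d' (M *m (if j == 0 then d else e))) / det2 d' e').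

Lemma trans_mxE M d e d' e' :
  [/\ trans_mx M d e d' e' 0 0 = det2 (M *m d) e' / det2 d' e',
      trans_mx M d e d' e' 0 1 = det2 (M *m e) e' / det2 d' e',
      trans_mx M d e d' e' 1 0 = det2 d' (M *m d) / det2 d' e' &
      trans_mx M d e d' e' 1 1 = det2 d' (M *m e) / det2 d' e'].
Proof. by split; rewrite mxE. Qed.

(** The origin of [den] and [slope]: they are the scalar and the new slope that appear when a vector
    [d + s *: e] is pushed forward. *)
Lemma trans_mxP M d e d' e' s : det2 d' e' != 0 ->
  let D := trans_mx M d e d' e' in D 0 0 + D 0 1 * s != 0 ->
  M *m (d + s *: e) = (D 0 0 + D 0 1 * s) *:
    (d' + ((D 1 0 + D 1 1 * s) / (D 0 0 + D 0 1 * s)) *: e').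
Proof.
move=> de0 /=; have [-> -> -> ->] := trans_mxE M d e d' e'.
move=> den0; rewrite scalerDr scalerA mulrCA divff// mulr1.
rewrite mulmxDr -scalemxAr [in LHS](cramer2 (M *m d) de0) [in LHS](cramer2 (M *m e) de0).
rewrite scalerDr !scalerA addrACA -!scalerDl.
by congr (_ *: _ + _ *: _); ring.
Qed.

Lemma cone_strict_scale (M M' : 'M[R]_2) k : 0 < k ->
  (forall i j, `|M' i j| = k * `|M i j|) -> cone_strict M -> cone_strict M'.
Proof.
move=> k0 MM [h1 h2]; rewrite /cone_strict !normrM !MM; split.
  by rewrite -!mulrDr ltr_pM2l.
move: h2; rewrite !normrM => h2.
have -> : k * `|M 1 1| * (k * `|M 0 0|) + k * `|M 0 1| * (k * `|M 1 0|) =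
  k ^+ 2 * (`|M 1 1| * `|M 0 0| + `|M 0 1| * `|M 1 0|) by ring.
have -> : (k * `|M 0 0| - k * `|M 0 1|) ^+ 2 =
  k ^+ 2 * (`|M 0 0| - `|M 0 1|) ^+ 2 by ring.
by rewrite ltr_pM2l// exprn_gt0.
Qed.

(** A line fixes its spanning vector only up to a scalar. If both vectors of each basis are scaled
    by factors of equal modulus, all entries change in modulus by one common factor, and the cone
    conditions are homogeneous. *)
Lemma trans_mx_scale M d e d' e' k m k' m' : k != 0 -> k' != 0 ->
  `|m| = `|k| -> `|m'| = `|k'| ->
  cone_strict (trans_mx M d e d' e') ->
  cone_strict (trans_mx M (k *: d) (m *: e) (k' *: d') (m' *: e')).
Proof.
move=> k0 k'0 mk mk'; apply: (@cone_strict_scale _ _ (`|k| / `|k'|)).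
  by rewrite divr_gt0 ?normr_gt0.
have dZl c u v : det2 (c *: u) v = c * det2 u v by rewrite /det2 !mxE; ring.
have dZr c u v : det2 u (c *: v) = c * det2 u v by rewrite /det2 !mxE; ring.
have nk' : `|k'| != 0 by rewrite normr_eq0.
move=> i j; rewrite !mxE !dZl !dZr.
have inv : `|(k' * (m' * det2 d' e'))^-1| = (`|k'| * `|k'|)^-1 * `|(det2 d' e')^-1|.
  by rewrite normfV !normrM mk' !normfV mulrA invfM.
case: ifP => _; case: ifP => _; rewrite -!scalemxAr ?dZl ?dZr !normrM ?mk ?mk' inv;
  by field.
Qed.

Lemma cone_strict_near (T : Type) (F : set_system T) (FF : Filter F)
    (M : T -> 'M[R]_2) (M0 : 'M[R]_2) :
  (forall i j, (fun t => M t i j) @ F --> M0 i j) -> cone_strict M0 ->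
  \forall t \near F, cone_strict (M t).
Proof.
move=> MM [h1 h2].
have nM i j : (fun t => `|M t i j|) @ F --> `|M0 i j| by apply: cvg_norm; exact: MM.
have c1 : (fun t => `|M t 0 0| - (`|M t 0 1| + `|M t 1 0| + `|M t 1 1|)) @ F -->
    `|M0 0 0| - (`|M0 0 1| + `|M0 1 0| + `|M0 1 1|).
  by apply: cvgB => //; apply: cvgD => //; apply: cvgD.
have c2 : (fun t => (`|M t 0 0| - `|M t 0 1|) * (`|M t 0 0| - `|M t 0 1|) -
    (`|M t 1 1 * M t 0 0| + `|M t 0 1 * M t 1 0|)) @ F -->
    (`|M0 0 0| - `|M0 0 1|) * (`|M0 0 0| - `|M0 0 1|) -
    (`|M0 1 1 * M0 0 0| + `|M0 0 1 * M0 1 0|).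
  apply: cvgB; first by apply: cvgM; apply: cvgB.
  by apply: cvgD; apply: cvg_norm; apply: cvgM.
have p1 : 0 < `|M0 0 0| - (`|M0 0 1| + `|M0 1 0| + `|M0 1 1|) by rewrite subr_gt0.
have p2 : 0 < (`|M0 0 0| - `|M0 0 1|) * (`|M0 0 0| - `|M0 0 1|) -
    (`|M0 1 1 * M0 0 0| + `|M0 0 1 * M0 1 0|) by rewrite subr_gt0 -expr2.
apply: filterS2 (cvgr_gt _ c1 _ p1) (cvgr_gt _ c2 _ p2) => t q1 q2.
by split; [rewrite -subr_gt0|rewrite -subr_gt0 expr2].
Qed.

Lemma proj_lineE w v i : (proj_line w *m v) i 0 =
  (enorm w ^+ 2)^-1 * (w 0 0 * v 0 0 + w 1 0 * v 1 0) * w i 0.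
Proof.
have e i' j' : proj_line w i' j' = (enorm w ^+ 2)^-1 * (w i' 0 * w j' 0).
  by rewrite !mxE big_ord1 !mxE.
by rewrite mulmx2E !e; ring.
Qed.

Lemma proj_line_colinear w v : proj_line w *m v =
  ((enorm w ^+ 2)^-1 * (w 0 0 * v 0 0 + w 1 0 * v 1 0)) *: w.
Proof. by apply: cV2P; rewrite proj_lineE mxE. Qed.

Lemma proj_line_id w : w != 0 -> proj_line w *m w = w.
Proof.
move=> w0; rewrite proj_line_colinear -!expr2 -enorm_sqr mulVf ?scale1r//.
by rewrite expf_neq0// gt_eqF// enorm_gt0.
Qed.

End Planar.

(** * Finitely many strict cones from projective hyperbolicity *)

Section Cocycle.
Variables (R : realType) (X : finType) (A : X -> 'M[R]_2).

Lemma cocycle_recr x n :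
  cocycle A x n.+1 = cocycle A (fun k => x k.+1) n *m A (x 0%N).
Proof.
by elim: n => [|n ih]; [rewrite /= mulmx1 mul1mx|rewrite [LHS]/= -mulmxA -ih].
Qed.

Lemma cocycle_addn x m n :
  cocycle A x (m + n) = cocycle A (fun k => x (m + k)%N) n *m cocycle A x m.
Proof. by elim: n => [|n ih]; [rewrite addn0 mul1mx|rewrite addnS /= ih mulmxA]. Qed.

Lemma eq_cocycle x y n : (forall k, (k < n)%N -> x k = y k) ->
  cocycle A x n = cocycle A y n.
Proof.
elim: n => [//|n ih] xy /=; rewrite xy// ih// => k kn; apply: xy.
exact: ltnW.
Qed.

Lemma cocycle_unit x n : (forall i, A i \in unitmx) -> cocycle A x n \in unitmx.
Proof.
move=> Au; elim: n => [|n ih] /=; first exact: unitmx1.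
by rewrite unitmx_mul Au.
Qed.

End Cocycle.

Section Convergence.
Variables (R : realType) (T : Type) (F : set_system T) (FF : ProperFilter F).
Implicit Types (d e : T -> 'cV[R]_2) (l m : 'cV[R]_2) (c : R).

Let cvgc d l := forall i, (fun t => d t i 0) @ F --> l i 0.

Lemma cvgc_det2 d e l m : cvgc d l -> cvgc e m ->
  (fun t => det2 (d t) (e t)) @ F --> det2 l m.
Proof. by move=> dd ee; apply: cvgB; apply: cvgM. Qed.

Lemma cvgc_mul (M : 'M[R]_2) d l : cvgc d l -> cvgc (fun t => M *m d t) (M *m l).
Proof.
move=> dd i; rewrite mulmx2E; under eq_fun do rewrite mulmx2E.
by apply: cvgD; apply: cvgMl_tmp.
Qed.

Lemma cvgc_scale (g : T -> R) c d l : g @ F --> c -> cvgc d l ->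
  cvgc (fun t => g t *: d t) (c *: l).
Proof.
by move=> gg dd i; rewrite mxE; under eq_fun do rewrite mxE; apply: cvgM.
Qed.

Lemma cvgc_enorm d l : cvgc d l -> (fun t => enorm (d t)) @ F --> enorm l.
Proof.
move=> dd; rewrite enormE; under eq_fun do rewrite enormE.
have h : (fun t => d t 0 0 ^+ 2 + d t 1 0 ^+ 2) @ F --> l 0 0 ^+ 2 + l 1 0 ^+ 2.
  by apply: cvgD; rewrite expr2; under eq_fun do rewrite expr2; apply: cvgM.
exact: cvg_comp h (@sqrt_continuous R _).
Qed.

Lemma cvgc_trans_mx (M : 'M[R]_2) d e d' e' l m l' m' :
  cvgc d l -> cvgc e m -> cvgc d' l' -> cvgc e' m' -> det2 l' m' != 0 ->
  forall i j, (fun t => trans_mx M (d t) (e t) (d' t) (e' t) i j) @ F -->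
    trans_mx M l m l' m' i j.
Proof.
move=> dd ee dd' ee' dm i j; rewrite mxE; under eq_fun do rewrite mxE.
have h : (fun t => (det2 (d' t) (e' t))^-1) @ F --> (det2 l' m')^-1.
  by apply: cvgV => //; exact: cvgc_det2.
by case: ifP => _; case: ifP => _; apply: cvgM => //;
  apply: cvgc_det2 => //; exact: cvgc_mul.
Qed.

End Convergence.

Section Hyperbolic.
Variables (R : realType) (X : finType) (E : rel X) (A : X -> 'M[R]_2).
Hypothesis Au : forall i, A i \in unitmx.
Implicit Types (x u z : int -> X) (L : (int -> X) -> 'cV[R]_2).

Let fwd x (k : nat) : X := x (Posz k).
Let coc x j := cocycle A (fwd x) j.

Lemma coc_shift x j : coc x j.+1 = coc (shift2 x) j *m A (x 0).
Proof.
rewrite /coc cocycle_recr; congr (_ *m _); apply: eq_cocycle => k _.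
by rewrite /fwd /shift2 -addn1 PoszD.
Qed.

(** Only the line of [L u] is continuous in [u], not the vector. Projecting the fixed vector [L x]
    onto that line gives a convergent choice of spanning vector near [x]. *)
Lemma line_field_cvg L x : line_field_continuous E L -> two_sided_shift E x ->
  L x != 0 ->
  forall i, (fun u => (proj_line (L u) *m L x) i 0) @ window_filter E x --> L x i 0.
Proof.
move=> cL Sx L0 i.
have h j : (fun u => proj_line (L u) i j) @ window_filter E x --> proj_line (L x) i j.
  apply/cvgrPdist_lt => e e0; have [N hN] := cL x Sx e e0.
  exists N => // u [Su ux]; rewrite /= distrC; exact: hN.
rewrite -[in X in _ --> X](proj_line_id L0) mulmx2E.
by under eq_fun do rewrite mulmx2E; apply: cvgD; apply: cvgMr_tmp.
Qed.

Lemma window_filter_proper x : two_sided_shift E x -> ProperFilter (window_filter E x).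
Proof. by move=> Sx; apply: filter_from_proper => N _; exists x; split. Qed.

Lemma shift2_cvg x : shift2 @ window_filter E x --> window_filter E (shift2 x).
Proof.
move=> B [N _ NB]; exists N.+1 => // u ux; apply: NB; exact: window_set_shift.
Qed.

Variables (Ed Ew : (int -> X) -> 'cV[R]_2) (n : nat).
Hypothesis indep : forall x, two_sided_shift E x ->
  forall a b : R, a *: Ed x + b *: Ew x = 0 -> a = 0 /\ b = 0.
Hypotheses (cEd : line_field_continuous E Ed) (cEw : line_field_continuous E Ew).
Hypothesis inv : forall x, two_sided_shift E x ->
  (exists c : R, A (x 0) *m Ed x = c *: Ed (shift2 x)) /\
  (exists c : R, A (x 0) *m Ew x = c *: Ew (shift2 x)).
Hypothesis n_gt0 : (1 <= n)%N.
Hypothesis dom : forall x, two_sided_shift E x ->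
  enorm (coc x n *m Ew x) / enorm (Ew x) < enorm (coc x n *m Ed x) / enorm (Ed x).

Lemma det2_splitting x : two_sided_shift E x -> det2 (Ed x) (Ew x) != 0.
Proof.
move=> Sx; apply/eqP => d0.
have h i : Ew x i 0 = 0 /\ - Ed x i 0 = 0.
  apply: (indep Sx); apply: cV2P; rewrite !mxE; move: d0; rewrite /det2;
    have [->|->] : i = 0 \/ i = 1 by
      [case: i => -[|[|//]] ?; [left|right]; exact/val_inj]; lra.
have [] := indep Sx (a := 1) (b := 0) _.
  apply: cV2P; rewrite !mxE mul0r addr0 mul1r.
    by have [_ /eqP] := h 0; rewrite oppr_eq0 => /eqP.
  by have [_ /eqP] := h 1; rewrite oppr_eq0 => /eqP.
by move/eqP; rewrite oner_eq0.
Qed.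

Let Ed0 x : two_sided_shift E x -> Ed x != 0.
Proof. by move=> /det2_splitting/det2_neq0[]. Qed.

Let Ew0 x : two_sided_shift E x -> Ew x != 0.
Proof. by move=> /det2_splitting/det2_neq0[]. Qed.

Let nd x j : two_sided_shift E x -> 0 < enorm (coc x j *m Ed x).
Proof.
by move=> Sx; rewrite enorm_gt0// unitmx_mul_neq0 ?Ed0// cocycle_unit.
Qed.

Let nw x j : two_sided_shift E x -> 0 < enorm (coc x j *m Ew x).
Proof.
by move=> Sx; rewrite enorm_gt0// unitmx_mul_neq0 ?Ew0// cocycle_unit.
Qed.

(* Adapted norm: weighting Ew x by the inverse of this sum turns the domination
   in n steps into a domination in one step, as the sum telescopes. *)
Definition adapted_sum x := \sum_(j < n) enorm (coc x j *m Ew x) / enorm (coc x j *m Ed x).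
Definition adapted_weak x := (adapted_sum x)^-1 *: Ew x.

Lemma adapted_sum_gt0 x : two_sided_shift E x -> 0 < adapted_sum x.
Proof.
move=> Sx; rewrite /adapted_sum; case: n n_gt0 => // m _; rewrite big_ord_recl.
rewrite ltr_pwDl//; first by rewrite divr_gt0 ?nw ?nd.
by apply: sumr_ge0 => j _; rewrite divr_ge0 ?enorm_ge0.
Qed.

Lemma det2_adapted x : two_sided_shift E x -> det2 (Ed x) (adapted_weak x) != 0.
Proof.
move=> Sx; have -> : det2 (Ed x) (adapted_weak x) =
    (adapted_sum x)^-1 * det2 (Ed x) (Ew x) by rewrite /det2 !mxE; ring.
by rewrite mulf_neq0 ?det2_splitting// invr_eq0 gt_eqF// adapted_sum_gt0.
Qed.

(** By invariance of the splitting the matrix is diagonal, with entries [al] and [s^-1 * be * s'],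
    so both cone conditions reduce to the inequality [key]. *)
Lemma cone_strict_splitting x : two_sided_shift E x ->
  cone_strict (trans_mx (A (x 0)) (Ed x) (adapted_weak x)
    (Ed (shift2 x)) (adapted_weak (shift2 x))).
Proof.
move=> Sx; have Sx' := two_sided_shift_shift Sx.
have [[al hal] [be hbe]] := inv Sx.
have s0 := adapted_sum_gt0 Sx; have s'0 := adapted_sum_gt0 Sx'.
have D0 := det2_adapted Sx'.
have al0 : al != 0.
  apply: contraTneq (unitmx_mul_neq0 (Au (x 0)) (Ed0 Sx)) => al0.
  by rewrite hal al0 scale0r eqxx.
have be0 : be != 0.
  apply: contraTneq (unitmx_mul_neq0 (Au (x 0)) (Ew0 Sx)) => be0.
  by rewrite hbe be0 scale0r eqxx.
set s := adapted_sum x in s0 *; set s' := adapted_sum (shift2 x) in s'0 *.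
have [e00 e01 e10 e11] := trans_mxE (A (x 0)) (Ed x) (adapted_weak x)
    (Ed (shift2 x)) (adapted_weak (shift2 x)).
have {}e00 : trans_mx (A (x 0)) (Ed x) (adapted_weak x)
    (Ed (shift2 x)) (adapted_weak (shift2 x)) 0 0 = al.
  by rewrite e00 hal; apply: (mulIf D0); rewrite divfK// /det2 !mxE; ring.
have Aw : A (x 0) *m adapted_weak x = (s^-1 * be * s') *: adapted_weak (shift2 x).
  rewrite -scalemxAr hbe /adapted_weak !scalerA -/s -/s'.
  by congr (_ *: _); rewrite mulfK// gt_eqF.
have {}e01 : trans_mx (A (x 0)) (Ed x) (adapted_weak x)
    (Ed (shift2 x)) (adapted_weak (shift2 x)) 0 1 = 0.
  by rewrite e01 Aw; apply: (mulIf D0); rewrite divfK// /det2 !mxE; ring.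
have {}e10 : trans_mx (A (x 0)) (Ed x) (adapted_weak x)
    (Ed (shift2 x)) (adapted_weak (shift2 x)) 1 0 = 0.
  by rewrite e10 hal; apply: (mulIf D0); rewrite divfK// /det2 !mxE; ring.
have {}e11 : trans_mx (A (x 0)) (Ed x) (adapted_weak x)
    (Ed (shift2 x)) (adapted_weak (shift2 x)) 1 1 = s^-1 * be * s'.
  by rewrite e11 Aw; apply: (mulIf D0); rewrite divfK// /det2 !mxE; ring.
have key : `|be| * s' < `|al| * s.
  pose rr y j := enorm (coc y j *m Ew y) / enorm (coc y j *m Ed y).
  have step j : `|be| * rr (shift2 x) j = `|al| * rr x j.+1.
    rewrite /rr !coc_shift -!mulmxA hal hbe -!scalemxAr !enormZ.
    have := nd j Sx'; have : `|al| != 0 by rewrite normr_eq0.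
    by move=> h1 h2; field; rewrite h1 gt_eqF.
  (* Passing to the shifted path moves each ratio one index up: the ratio of index 0 is lost and
     that of index [n] appears, and domination says that the latter is smaller. *)
  have -> : `|be| * s' = `|al| * (s - rr x 0%N + rr x n).
    rewrite /s' /adapted_sum mulr_sumr.
    rewrite (eq_bigr (fun j : 'I_n => `|al| * rr x j.+1)); last by move=> j _; exact: step.
    rewrite -mulr_sumr; congr (_ * _); rewrite /s /adapted_sum.
    have : \sum_(j < n.+1) rr x j = rr x 0%N + \sum_(j < n) rr x j.+1.
      by rewrite big_ord_recl.
    rewrite big_ord_recr /= => h; apply: (addrI (rr x 0%N)); rewrite -h.
    by rewrite [in RHS]addrA addrCA subrr addr0.
  rewrite ltr_pM2l ?normr_gt0//.
  suff : rr x n < rr x 0%N by lra.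
  have := dom Sx; rewrite /rr {3 4}/coc /= !mul1mx.
  have h1 := nd n Sx; have h2 := enorm_gt0 (Ew0 Sx); have h3 := enorm_gt0 (Ed0 Sx).
  rewrite !ltr_pdivrMr// mulrAC ltr_pdivlMr// => h.
  by rewrite mulrAC ltr_pdivlMr// [ltRHS]mulrC; exact: h.
rewrite /cone_strict e00 e01 e10 e11 !normr0 !mul0r normr0 !add0r addr0 subr0.
have lt1 : `|s^-1 * be * s'| < `|al|.
  rewrite -mulrA mulrC !normrM normfV (gtr0_norm s0) (gtr0_norm s'0).
  by rewrite ltr_pdivrMr.
by split=> //; rewrite normrM expr2 ltr_pM2r// normr_gt0.
Qed.

(** Source and target bases come from two different paths, since the representative of a word and
    that of the next word need not be shifts of each other; hence the product filter. The limit is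
    taken with projected vectors, then transferred to the given ones. *)
Lemma cone_strict_local x : two_sided_shift E x -> exists N, forall u z,
  window_set E x N u -> window_set E x N z ->
  cone_strict (trans_mx (A (u 0)) (Ed u) (adapted_weak u)
    (Ed (shift2 z)) (adapted_weak (shift2 z))).
Proof.
move=> Sx; have Sx' := two_sided_shift_shift Sx.
pose dd y u := proj_line (Ed u) *m Ed y; pose ee y u := proj_line (Ew u) *m Ew y.
pose rr y u := \sum_(j < n) enorm (coc y j *m ee y u) / enorm (coc y j *m dd y u).
have PF := window_filter_proper Sx; have PF' := window_filter_proper Sx'.
have cdd y : two_sided_shift E y ->
    forall i, (fun u => dd y u i 0) @ window_filter E y --> Ed y i 0.
  by move=> Sy; apply: line_field_cvg => //; exact: Ed0.
have cee y : two_sided_shift E y ->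
    forall i, (fun u => ee y u i 0) @ window_filter E y --> Ew y i 0.
  by move=> Sy; apply: line_field_cvg => //; exact: Ew0.
have crr y : two_sided_shift E y -> rr y @ window_filter E y --> adapted_sum y.
  move=> Sy; have PFy := window_filter_proper Sy.
  apply: cvg_sumr => j; apply: cvgM.
    by apply: cvgc_enorm; apply: cvgc_mul; exact: cee.
  apply: cvgV; first by rewrite gt_eqF// nd.
  by apply: cvgc_enorm; apply: cvgc_mul; exact: cdd.
have cwe y : two_sided_shift E y -> forall i,
    (fun u => ((rr y u)^-1 *: ee y u) i 0) @ window_filter E y --> adapted_weak y i 0.
  move=> Sy; have PFy := window_filter_proper Sy.
  apply: cvgc_scale; last exact: cee.
  by apply: cvgV; [rewrite gt_eqF// adapted_sum_gt0|exact: crr].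
have near0 y : two_sided_shift E y -> \forall u \near window_filter E y,
    (0 < enorm (dd y u)) /\ (0 < enorm (ee y u)).
  move=> Sy; have PFy := window_filter_proper Sy.
  have h1 := cvgc_enorm PFy (cdd y Sy); have h2 := cvgc_enorm PFy (cee y Sy).
  have g1 : \forall u \near window_filter E y, 0 < enorm (dd y u).
    by apply: cvgr_gt h1 _ _; exact/enorm_gt0/Ed0.
  have g2 : \forall u \near window_filter E y, 0 < enorm (ee y u).
    by apply: cvgr_gt h2 _ _; exact/enorm_gt0/Ew0.
  by apply: filterS2 g1 g2.
(* The weight in [adapted_weak] compensates for the choice of spanning vectors up to sign, so the
   two rescaling factors have equal modulus. Agreement on [n] letters makes the cocycles of [u] and
   [y] equal. *)
have renorm y u : two_sided_shift E u -> (forall k : nat, (k < n)%N -> u k%:Z = y k%:Z) ->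
    0 < enorm (dd y u) -> 0 < enorm (ee y u) -> exists k m,
    [/\ k != 0, `|m| = `|k|, Ed u = k *: dd y u &
        adapted_weak u = m *: ((rr y u)^-1 *: ee y u)].
  move=> Su uy d0 e0.
  have [k dk] : exists k, dd y u = k *: Ed u by eexists; exact: proj_line_colinear.
  have [l el] : exists l, ee y u = l *: Ew u by eexists; exact: proj_line_colinear.
  have k0 : k != 0.
    by apply: contraTneq d0 => k0; rewrite dk k0 enormZ normr0 mul0r ltxx.
  have l0 : l != 0.
    by apply: contraTneq e0 => l0; rewrite el l0 enormZ normr0 mul0r ltxx.
  have cu j : (j <= n)%N -> coc y j = coc u j.
    move=> jn; apply: eq_cocycle => i ij; rewrite /fwd uy//.
    exact: leq_trans jn.
  have nk : `|k| != 0 by rewrite normr_eq0.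
  have nl : `|l| != 0 by rewrite normr_eq0.
  have rE : rr y u = `|l| / `|k| * adapted_sum u.
    rewrite /rr /adapted_sum mulr_sumr; apply: eq_bigr => j _.
    have hm c v : enorm (coc u j *m (c *: v)) = `|c| * enorm (coc u j *m v).
      by rewrite -scalemxAr enormZ.
    rewrite (cu j (ltnW (ltn_ord j))) dk el (hm k) (hm l).
    have h := nd j Su; by field; rewrite nk gt_eqF.
  have s0 := adapted_sum_gt0 Su.
  exists k^-1, (`|l| / (`|k| * l)); split.
  - by rewrite invr_eq0.
  - by rewrite normf_div normrM !normr_id normfV; field; rewrite nk.
  - by rewrite dk scalerA mulVf// scale1r.
  - rewrite el rE !scalerA /adapted_weak; congr (_ *: _).
    by field; rewrite nk nl l0 gt_eqF.
have near1 : \forall p \near filter_prod (window_filter E x) (window_filter E x),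
  cone_strict (trans_mx (A (x 0)) (dd x p.1) ((rr x p.1)^-1 *: ee x p.1)
    (dd (shift2 x) (shift2 p.2))
    ((rr (shift2 x) (shift2 p.2))^-1 *: ee (shift2 x) (shift2 p.2))).
  apply: cone_strict_near (cone_strict_splitting Sx).
  have f1 (f : (int -> X) -> 'cV[R]_2) (v : 'cV[R]_2) :
      (forall i, (fun u => f u i 0) @ window_filter E x --> v i 0) ->
      forall i, (fun p => f p.1 i 0) @
        filter_prod (window_filter E x) (window_filter E x) --> v i 0.
    by move=> h i; apply: cvg_comp (h i); exact: cvg_fst.
  have f2 (f : (int -> X) -> 'cV[R]_2) (v : 'cV[R]_2) :
      (forall i, (fun u => f u i 0) @ window_filter E (shift2 x) --> v i 0) ->
      forall i, (fun p => f (shift2 p.2) i 0) @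
        filter_prod (window_filter E x) (window_filter E x) --> v i 0.
    move=> h i; apply: cvg_comp (h i); apply: cvg_comp (@shift2_cvg x).
    exact: cvg_snd.
  apply: cvgc_trans_mx.
  - exact: (f1 (dd x) (Ed x) (cdd _ Sx)).
  - exact: (f1 (fun u => (rr x u)^-1 *: ee x u) (adapted_weak x) (cwe _ Sx)).
  - exact: (f2 (dd (shift2 x)) (Ed (shift2 x)) (cdd _ Sx')).
  - exact: (f2 (fun u => (rr (shift2 x) u)^-1 *: ee (shift2 x) u)
      (adapted_weak (shift2 x)) (cwe _ Sx')).
  - exact: det2_adapted.
have near2 := near0 _ Sx.
have near3 : \forall z \near window_filter E x,
    (0 < enorm (dd (shift2 x) (shift2 z))) /\ (0 < enorm (ee (shift2 x) (shift2 z))).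
  exact: (@shift2_cvg x _ (near0 _ Sx')).
have [[B1 B2] /= [[N1 _ NB1] [N2 _ NB2]] hB] := near1.
have [N3 _ hN3] := near2; have [N4 _ hN4] := near3.
pose N := maxn (maxn N1 N2) (maxn (maxn N3 N4) n).
have [l1 l2 l3 l4 ln] : [/\ (N1 <= N)%N, (N2 <= N)%N, (N3 <= N)%N, (N4 <= N)%N & (n <= N)%N].
  by rewrite /N; split; rewrite !leq_max leqnn ?orbT.
exists N => u z ux zx.
have u0 : u 0 = x 0 by apply: ux.2; rewrite normr0.
have := hB (u, z) (conj (NB1 _ (window_setS l1 ux)) (NB2 _ (window_setS l2 zx))).
have [a1 a2] := hN3 _ (window_setS l3 ux); have [a3 a4] := hN4 _ (window_setS l4 zx).
have uk k : (k < n)%N -> u k%:Z = x k%:Z.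
  by move=> kn; apply: ux.2; rewrite lez_nat (leq_trans (ltnW kn)).
have zk k : (k < n)%N -> shift2 z k%:Z = shift2 x k%:Z.
  move=> kn; apply: zx.2; rewrite -PoszD lez_nat addn1; exact: leq_trans ln.
have [k [m [k0 mk -> ->]]] := renorm x u ux.1 uk a1 a2.
have [k' [m' [k'0 mk' -> ->]]] :=
  renorm (shift2 x) (shift2 z) (two_sided_shift_shift zx.1) zk a3 a4.
by rewrite u0 /=; exact: trans_mx_scale.
Qed.

End Hyperbolic.

Lemma hyperbolic_windows (R : realType) (X : finType) (E : rel X) (A : X -> 'M[R]_2) :
  (forall i, A i \in unitmx) -> proj_unif_hyp E A ->
  exists (N : nat) (dv ev : (int -> X) -> 'cV[R]_2),
    (forall x, two_sided_shift E x -> det2 (dv x) (ev x) != 0) /\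
    (forall x u v, two_sided_shift E x -> window_set E x N u ->
       window_set E (shift2 x) N v ->
       cone_strict (trans_mx (A (x 0)) (dv u) (ev u) (dv v) (ev v))).
Proof.
move=> Au [Ed [Ew [indep cEd cEw inv [n [n1 dom]]]]].
have loc := cone_strict_local Au indep cEd cEw inv n1 dom.
pose Q (B : set (int -> X)) := forall u z, B u -> B z ->
  cone_strict (trans_mx (A (u 0)) (Ed u) (adapted_weak A Ed Ew n u)
    (Ed (shift2 z)) (adapted_weak A Ed Ew n (shift2 z))).
have [||N hN] := @two_sided_shift_compact X E Q.
- by move=> B C BC QC u z Bu Bz; apply: QC; exact: BC.
- by move=> x /loc[N hN]; exists N.
(* One letter more on each side: [v] is controlled around the shifted origin, and shifting it back
   costs one letter. *)
exists N.+1, Ed, (adapted_weak A Ed Ew n); split.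
  by move=> x Sx; apply: (det2_adapted Au indep n1 Sx).
move=> x u v Sx ux vx.
pose z k := v (k - 1).
have vz : v = shift2 z by apply/funext => k; rewrite /shift2 /z addrK.
have zx : window_set E x N z.
  split=> [k|k kN]; first by rewrite /z addrAC; exact: vx.1.
  rewrite /z vx.2 /shift2 ?subrK//.
  apply: le_trans (ler_normB _ _) _; rewrite normr1 intS addrC lerD2l//.
have u0 : x 0 = u 0 by rewrite ux.2// normr0.
rewrite vz u0; apply: hN Sx _ _ _ zx.
exact: window_setS ux.
Qed.

(** * The chain of windows *)

Section WindowChain.
Variables (X : finType) (N : nat).

Definition window : finType := {ffun 'I_(N + N).+1 -> X}.
Implicit Types (y : window) (a : X) (x : nat -> X).

Definition wnext y a : window :=
  [ffun i : 'I_(N + N).+1 => if (i < N + N)%N then y (inord i.+1) else a].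
Definition wlast y : X := y ord_max.
Definition wmid y : X := y (inord N).
Definition win x j : window := [ffun i : 'I_(N + N).+1 => x (j + i)%N].

Lemma win_next x j : wnext (win x j) (x (j + (N + N).+1)%N) = win x j.+1.
Proof.
apply/ffunP => i; rewrite !ffunE; case: ifP => iN.
  by rewrite inordK ?ltnS// addnS addSn.
have -> : i = ord_max :> 'I_(N + N).+1.
  by apply/val_inj/eqP; rewrite eqn_leq -ltnS ltn_ord/= leqNgt iN.
by rewrite addnS addSn.
Qed.

Lemma win_last x j : wlast (win x j) = x (j + (N + N))%N.
Proof. by rewrite /wlast ffunE. Qed.

Lemma win_mid x j : wmid (win x j) = x (N + j)%N.
Proof. by rewrite /wmid ffunE inordK 1?addnC// ltnS leq_addr. Qed.

Lemma eq_win x x' j : (forall k, (k <= j + (N + N))%N -> x k = x' k) ->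
  win x j = win x' j.
Proof.
by move=> xx; apply/ffunP => i; rewrite !ffunE xx// leq_add2l -ltnS.
Qed.

Variables (R : realType) (E : rel X) (P : X -> X -> R).
Hypothesis PE : forall i j, (0 < P i j) = E i j.
Hypothesis E_connect : forall i j, connect E i j.

(** The possible next letters depend only on the last letter of a word, so inadmissible words move
    as well: follow a path from that letter to [x0 0], then [x0] itself until the whole word is
    overwritten. *)
Lemma window_reach x0 : (forall n, E (x0 n) (x0 n.+1)) -> forall y, connect
  (fun y y' : window => [exists a, (0 < P (wlast y) a) && (wnext y a == y')])
  y (win x0 0).
Proof.
move=> x0E y; set b := wlast y.
have [p pp p0] := connectP (E_connect b (x0 0%N)).
pose x k := if (k <= size p)%N then nth b (b :: p) k else x0 (k - size p)%N.
have x0s i : x (size p + i)%N = x0 i.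
  rewrite /x; case: i => [|i]; last by rewrite addnS ltnNge leq_addr /= -addnS addKn.
  by rewrite addn0 leqnn p0 (last_nth b).
have xE k : E (x k) (x k.+1).
  have [kp|kp] := ltnP k (size p).
    by rewrite /x kp (ltnW kp); move/pathP: pp; apply.
  by rewrite -(subnKC kp) -addnS !x0s.
pose Ys := fix Ys k := if k is k'.+1 then wnext (Ys k') (x k) else y.
have YsE k (i : 'I_(N + N).+1) : (N + N <= k + i)%N ->
    Ys k i = x (k + i - (N + N))%N.
  elim: k i => [|k ih] i; rewrite ?add0n.
    move=> iN; have -> : i = ord_max.
      by apply/val_inj/eqP; rewrite eqn_leq -ltnS ltn_ord.
    by rewrite /= subnn.
  move=> ki; rewrite /= ffunE; case: ifP => iN.
    by rewrite ih inordK ?ltnS// -?addSnnS.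
  have -> : i = ord_max :> 'I_(N + N).+1.
    by apply/val_inj/eqP; rewrite eqn_leq -ltnS ltn_ord/= leqNgt iN.
  by rewrite /= addnK.
have cY k : connect (fun y y' : window =>
    [exists a, (0 < P (wlast y) a) && (wnext y a == y')]) y (Ys k).
  elim: k => [|k ih]; first exact: connect0.
  apply: connect_trans ih (connect1 _); apply/existsP; exists (x k.+1).
  by rewrite eqxx andbT PE /wlast YsE ?leq_addl// addnK.
have <- : Ys (size p + (N + N))%N = win x0 0; last exact: cY.
apply/ffunP => i; rewrite YsE; last by rewrite addnAC leq_addl.
by rewrite addnAC addnK x0s /win [RHS]ffunE.
Qed.

End WindowChain.

Section Extension.
Variables (X : finType) (E : rel X).
Hypothesis pred_ex : forall i, exists j, E j i.

(** Hyperbolicity speaks of bi-infinite paths and the process of one-sided ones; iterating a choice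
    of predecessors supplies a past. *)
Lemma two_sided_extension (x : nat -> X) : (forall n, E (x n) (x n.+1)) ->
  exists z, two_sided_shift E z /\ forall n : nat, z n%:Z = x n.
Proof.
move=> xE; have [pr prE] := choice pred_ex.
exists (fun k => match k with Posz n => x n | Negz n => iter n.+1 pr (x 0%N) end).
split=> // -[n|[|n]].
- by rewrite -PoszD addn1.
- exact: prE.
- have -> : Negz n.+1 + 1 = Negz n by rewrite !NegzE [n.+2%:Z]intS opprD addrAC addNr add0r.
  exact: prE.
Qed.

End Extension.

Section HyperbolicSystem.
Variables (R : realType) (X : finType) (E : rel X) (A : X -> 'M[R]_2).
Hypothesis Au : forall i, A i \in unitmx.
Hypothesis pred_ex : forall i, exists j, E j i.
Hypothesis path_ex : exists x : nat -> X, forall n, E (x n) (x n.+1).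

Lemma hyperbolic_system : proj_unif_hyp E A ->
  exists (N : nat) (dv ev : window X N -> 'cV[R]_2) (good : window X N -> X -> bool),
  [/\ forall y a, good y a ->
        det2 (dv y) (ev y) != 0 /\ det2 (dv (wnext y a)) (ev (wnext y a)) != 0,
      forall y a, good y a -> cone_strict
        (trans_mx (A (wmid y)) (dv y) (ev y) (dv (wnext y a)) (ev (wnext y a)))
    & forall x : nat -> X, (forall n, E (x n) (x n.+1)) ->
        forall j, good (win N x j) (x (j + (N + N).+1)%N)].
Proof.
move=> /(hyperbolic_windows Au)[N [dv [ev [dv0 strict]]]].
pose zwin (u : int -> X) : window X N :=
  [ffun i : 'I_(N + N).+1 => u (i%:Z - N%:Z)].
have zwinP u v : zwin u = zwin v -> forall k : int, `|k| <= N%:Z -> u k = v k.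
  move=> uv k kN; have kN0 : 0 <= k + N%:Z.
    by move: kN; rewrite ler_norml => /andP[h _]; rewrite -lerBlDr sub0r.
  have kN1 : (absz (k + N%:Z)%R < (N + N).+1)%N.
    rewrite ltnS -lez_nat gez0_abs// PoszD lerD2r.
    by apply: le_trans kN; exact: ler_norm.
  have := congr1 (fun f : window X N => f (Ordinal kN1)) uv; rewrite !ffunE /=.
  by rewrite gez0_abs// addrK.
have zwin_mid u : wmid (zwin u) = u 0.
  by rewrite /wmid ffunE inordK ?subrr// ltnS leq_addr.
have zwin_next u : wnext (zwin u) (u N.+1%:Z) = zwin (shift2 u).
  apply/ffunP => i; rewrite !ffunE /shift2; case: ifP => iN.
    by rewrite inordK ?ltnS// intS; congr u; ring.
  have -> : i = ord_max :> 'I_(N + N).+1.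
    by apply/val_inj/eqP; rewrite eqn_leq -ltnS ltn_ord/= leqNgt iN.
  by rewrite /= PoszD addrK intS addrC.
have [x0 x0E] := path_ex; have [z0 [Sz0 _]] := two_sided_extension pred_ex x0E.
(* [rp] picks a path through each word, and the arbitrary path [z0] for words that occur on none. *)
have /choice[rp rpP] (y : window X N) : exists u, two_sided_shift E u /\
    ((exists v, two_sided_shift E v /\ zwin v = y) -> zwin u = y).
  have [[v [Sv vy]]|nv] := pselect (exists v, two_sided_shift E v /\ zwin v = y).
    by exists v.
  by exists z0.
(* A path reading [y] and then [a] is the base point around which both representatives are close, as
   [strict] demands. *)
pose good y a := `[< exists u, [/\ two_sided_shift E u, zwin u = y & u N.+1%:Z = a] >].
have rpw u : two_sided_shift E u -> window_set E u N (rp (zwin u)).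
  move=> Su; split; first by have [] := rpP (zwin u).
  by apply: zwinP; apply: (rpP _).2; exists u.
exists N, (dv \o rp), (ev \o rp), good; split.
- by move=> y a _; split; exact: dv0 (rpP _).1.
- move=> y a /asboolP[u [Su <- <-]]; rewrite zwin_mid zwin_next /=.
  by apply: strict => //; [exact: rpw|apply: rpw; exact: two_sided_shift_shift].
- move=> x xE j; apply/asboolP.
  have [z [Sz zx]] := two_sided_extension pred_ex xE.
  (* The origin moves to time [j + N], the centre of the word that starts at [j]. *)
  exists (fun k => z (k + (j + N)%:Z)); split.
  + by move=> k; rewrite addrAC; exact: Sz.
  + apply/ffunP => i; rewrite !ffunE -zx; congr z.
    by rewrite !PoszD; ring.
  + by rewrite -zx; congr z; rewrite -PoszD addnCA addSn.
Qed.

End HyperbolicSystem.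

(** * Growth of the cocycle *)

Section Growth.
Variable R : realType.
Implicit Types (u v d e : 'cV[R]_2) (M : 'M[R]_2) (k l : R).

Lemma normr_le_enorm v i : `|v i 0| <= enorm v.
Proof.
rewrite -sqrtr_sqr enormE ler_wsqrtr//.
have [->|->] : i = 0 \/ i = 1 by
  [case: i => -[|[|//]] ?; [left|right]; exact/val_inj].
  by rewrite lerDl sqr_ge0.
by rewrite lerDr sqr_ge0.
Qed.

Lemma enorm_le_sum v : enorm v <= `|v 0 0| + `|v 1 0|.
Proof.
have s0 : 0 <= `|v 0 0| + `|v 1 0| by rewrite addr_ge0.
rewrite -(ger0_norm s0) -sqrtr_sqr enormE ler_wsqrtr// sqrrD.
by rewrite !real_normK ?num_real// lerD2r lerDl mulrn_wge0// mulr_ge0.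
Qed.

(** The factor 2 makes a coordinatewise proof possible and is harmless: constants vanish once
    logarithms are divided by [n]. *)
Lemma enormD_le u v : enorm (u + v) <= 2 * (enorm u + enorm v).
Proof.
apply: le_trans (enorm_le_sum _) _; rewrite !mxE.
have := ler_normD (u 0 0) (v 0 0); have := ler_normD (u 1 0) (v 1 0).
have := normr_le_enorm u 0; have := normr_le_enorm u 1.
have := normr_le_enorm v 0; have := normr_le_enorm v 1.
lra.
Qed.

Lemma det2_le u v : `|det2 u v| <= 2 * (enorm u * enorm v).
Proof.
apply: le_trans (ler_normB _ _) _; rewrite !normrM mulr_natl mulr2n.
by apply: lerD; apply: ler_pM; rewrite ?normr_ge0// normr_le_enorm.
Qed.

Lemma det2x2E M : \det M = M 0 0 * M 1 1 - M 0 1 * M 1 0.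
Proof.
rewrite (expand_det_row M 0) sum2E /cofactor !det_mx11 !mxE /=.
have -> : lift 0 0 = 1 :> 'I_2 by exact/val_inj.
have -> : lift 1 0 = 0 :> 'I_2 by exact/val_inj.
by rewrite expr0 expr1; ring.
Qed.

Lemma opnorm_basis u0 u1 : det2 u0 u1 != 0 -> exists K : R, 0 < K /\
  forall M, enorm (M *m u0) <= K * opnorm M /\
    opnorm M <= K * (enorm (M *m u0) + enorm (M *m u1)).
Proof.
move=> de0; have nde0 : 0 < `|det2 u0 u1| by rewrite normr_gt0.
(* Cramer's rule bounds the coordinates of a unit vector; one factor 2 comes from [det2_le], the
   other from [enormD_le]. *)
pose K0 := 4 * (enorm u0 + enorm u1) / `|det2 u0 u1|.
have n0 := enorm_ge0 u0; have n1 := enorm_ge0 u1.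
have K00 : 0 <= K0 by rewrite divr_ge0 ?mulr_ge0 ?addr_ge0.
have ubd M v : enorm v = 1 -> enorm (M *m v) <= K0 * (enorm (M *m u0) + enorm (M *m u1)).
  move=> v1; rewrite [in leLHS](cramer2 v de0) mulmxDr -!scalemxAr.
  apply: le_trans (enormD_le _ _) _; rewrite !enormZ.
  have e0 := enorm_ge0 (M *m u0); have e1 := enorm_ge0 (M *m u1).
  have h0 : `|det2 v u1 / det2 u0 u1| <= K0 / 2.
    rewrite normrM normfV /K0 mulrAC ler_pM2r ?invr_gt0//.
    by have := det2_le v u1; rewrite v1 mul1r; lra.
  have h1 : `|det2 u0 v / det2 u0 u1| <= K0 / 2.
    rewrite normrM normfV /K0 mulrAC ler_pM2r ?invr_gt0//.
    by have := det2_le u0 v; rewrite v1 mulr1; lra.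
  have := ler_wpM2r e0 h0; have := ler_wpM2r e1 h1.
  have -> : K0 * (enorm (M *m u0) + enorm (M *m u1)) =
    2 * (K0 / 2 * enorm (M *m u0) + K0 / 2 * enorm (M *m u1)) by field.
  lra.
have [u00 _] := det2_neq0 de0; have pu0 := enorm_gt0 u00.
exists (K0 + enorm u0); split; first lra.
move=> M; have e0 := enorm_ge0 (M *m u0); have e1 := enorm_ge0 (M *m u1).
have hub : ubound [set enorm (M *m v) | v in [set v : 'cV[R]_2 | enorm v = 1]]
    (K0 * (enorm (M *m u0) + enorm (M *m u1))).
  by move=> _ [v /= v1 <-]; exact: ubd.
have unit0 : enorm ((enorm u0)^-1 *: u0) = 1.
  by rewrite enormZ normfV gtr0_norm// mulVf// gt_eqF.
have op0 : enorm (M *m ((enorm u0)^-1 *: u0)) <= opnorm M.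
  apply: ub_le_sup; first by exists (K0 * (enorm (M *m u0) + enorm (M *m u1))).
  by exists ((enorm u0)^-1 *: u0).
have opp : 0 <= opnorm M := le_trans (enorm_ge0 _) op0.
split.
  move: op0; rewrite -scalemxAr enormZ normfV gtr0_norm// ler_pdivrMl// => h.
  by apply: le_trans h _; rewrite ler_wpM2r// lerDr.
apply: le_trans (_ : K0 * (enorm (M *m u0) + enorm (M *m u1)) <= _).
  apply: ge_sup => //; exists (enorm (M *m ((enorm u0)^-1 *: u0))).
  by exists ((enorm u0)^-1 *: u0).
by rewrite ler_wpM2r ?addr_ge0// lerDl ltW.
Qed.

Lemma cvg_avg_bounded (u : nat -> R) (C : R) : (forall n, `|u n| <= C) ->
  (fun n => n%:R^-1 * u n) @ \oo --> (0 : R).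
Proof.
move=> uC; apply/cvgrPdist_le => e e0; near=> n.
have n0 : 0 < n%:R :> R by rewrite ltr0n; near: n; exact: nbhs_infty_gt.
have nC : C / e <= n%:R by near: n; exact: nbhs_infty_ger.
rewrite sub0r normrN normrM gtr0_norm ?invr_gt0// ler_pdivrMl//.
by apply: le_trans (uC n) _; rewrite -ler_pdivrMr.
Unshelve. all: by end_near. Qed.

Lemma cvgn_addnK (u : nat -> R) l m :
  (fun n => u (n + m)%N) @ \oo --> l -> u @ \oo --> l.
Proof. by move=> ul; rewrite -(cvg_shiftn m u). Qed.

Lemma cvg_avg_shift (u : nat -> R) l (N : nat) :
  (fun n => n%:R^-1 * u n) @ \oo --> l ->
  (fun n => (n + N)%:R^-1 * u n) @ \oo --> l.
Proof.
move=> ul.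
have NN : (fun n => (n + N)%:R^-1 * N%:R) @ \oo --> (0 : R).
  by apply: (@cvgn_addn R (fun n => n%:R^-1 * N%:R));
    apply: (@cvg_avg_bounded _ N%:R) => n; rewrite ger0_norm.
have : (fun n => n%:R^-1 * u n - (n + N)%:R^-1 * N%:R * (n%:R^-1 * u n)) @ \oo --> l - 0 * l.
  by apply: cvgnB => //; apply: cvgM.
rewrite mul0r subr0; apply: cvg_trans; apply: near_eq_cvg; near=> n.
have n0 : 0 < n%:R :> R by rewrite ltr0n; near: n; exact: nbhs_infty_gt.
have nN0 : n%:R + N%:R != 0 :> R by rewrite gt_eqF// ltr_wpDr.
by rewrite natrD; field; rewrite nN0 gt_eqF.
Unshelve. all: by end_near. Qed.

(** The sum of the two image norms is at most twice the larger one, which explains [K * 2]; both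
    candidates for the larger one have rate [l]. *)
Lemma ln_opnorm_growth (M : nat -> 'M[R]_2) u0 u1 l : det2 u0 u1 != 0 ->
  (forall n, 0 < enorm (M n *m u0)) -> (forall n, 0 < enorm (M n *m u1)) ->
  (fun n => n%:R^-1 * ln (enorm (M n *m u0))) @ \oo --> l ->
  (fun n => n%:R^-1 * ln (enorm (M n *m u1))) @ \oo --> l ->
  (fun n => n%:R^-1 * ln (opnorm (M n))) @ \oo --> l.
Proof.
move=> de0 p0 p1 c0 c1; have [K [K0 hK]] := opnorm_basis de0.
have cK : (fun n => n%:R^-1 * ln K) @ \oo --> (0 : R) by exact: (@cvg_avg_bounded _ `|ln K|).
have cK2 : (fun n => n%:R^-1 * ln (K * 2)) @ \oo --> (0 : R).
  exact: (@cvg_avg_bounded _ `|ln (K * 2)|).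
apply/cvgrPdist_lt => e e0; have e2 : 0 < e / 2 by lra.
move/cvgrPdist_lt/(_ _ e2) : cK => cK; move/cvgrPdist_lt/(_ _ e2) : cK2 => cK2.
move/cvgrPdist_lt/(_ _ e2) : c0 => c0; move/cvgrPdist_lt/(_ _ e2) : c1 => c1.
near=> n.
have h0 : `|l - n%:R^-1 * ln (enorm (M n *m u0))| < e / 2 by near: n; exact: c0.
have h1 : `|l - n%:R^-1 * ln (enorm (M n *m u1))| < e / 2 by near: n; exact: c1.
have h2 : `|0 - n%:R^-1 * ln K| < e / 2 by near: n; exact: cK.
have h3 : `|0 - n%:R^-1 * ln (K * 2)| < e / 2 by near: n; exact: cK2.
have [k1 k2] := hK (M n).
have op0 : 0 < opnorm (M n).
  by rewrite -(pmulr_rgt0 _ K0); apply: lt_le_trans k1.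
have in0 : 0 <= n%:R^-1 :> R by rewrite invr_ge0.
have low : n%:R^-1 * ln (enorm (M n *m u0)) <=
    n%:R^-1 * ln K + n%:R^-1 * ln (opnorm (M n)).
  by rewrite -mulrDr ler_wpM2l// -lnM ?posrE// ler_ln ?posrE ?mulr_gt0.
have up (w : 'cV[R]_2) : 0 < enorm (M n *m w) ->
    enorm (M n *m u0) <= enorm (M n *m w) -> enorm (M n *m u1) <= enorm (M n *m w) ->
    n%:R^-1 * ln (opnorm (M n)) <= n%:R^-1 * ln (K * 2) + n%:R^-1 * ln (enorm (M n *m w)).
  move=> w0 w1 w2; rewrite -mulrDr ler_wpM2l// -lnM ?posrE ?mulr_gt0//.
  rewrite ler_ln ?posrE ?mulr_gt0//; apply: le_trans k2 _.
  by rewrite -mulrA ler_wpM2l ?(ltW K0)//; lra.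
move: h0 h1 h2 h3; rewrite !ltr_norml => /andP[a1 a2] /andP[b1 b2] /andP[a3 a4] /andP[a5 a6].
apply/andP; split; last lra.
have [le01|/ltW le10] := leP (enorm (M n *m u0)) (enorm (M n *m u1)).
  by have := up u1 (p1 n) le01 (lexx _); lra.
by have := up u0 (p0 n) (lexx _) le10; lra.
Unshelve. all: by end_near. Qed.

(** Adding a multiple of [e] does not change the determinant with [e], so [d + s *: e] cannot become
    short. *)
Lemma ln_enorm_cone d e : det2 d e != 0 -> exists K : R, 0 <= K /\
  forall s : R, `|s| <= 1 -> 0 < enorm (d + s *: e) /\ `|ln (enorm (d + s *: e))| <= K.
Proof.
move=> de0; have [d0 e0] := det2_neq0 de0.
have pe := enorm_gt0 e0; have pd := enorm_gt0 d0.
pose c1 := `|det2 d e| / (2 * enorm e); pose c2 := 2 * (enorm d + enorm e).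
have c1p : 0 < c1 by rewrite divr_gt0 ?normr_gt0 ?mulr_gt0.
exists (`|ln c1| + `|ln c2|); split; first by rewrite addr_ge0.
move=> s s1.
have h1 : c1 <= enorm (d + s *: e).
  have dE : det2 (d + s *: e) e = det2 d e by rewrite /det2 !mxE; ring.
  rewrite /c1 ler_pdivrMr ?mulr_gt0//; have := det2_le (d + s *: e) e.
  by rewrite dE mulrCA.
have p0 : 0 < enorm (d + s *: e) := lt_le_trans c1p h1.
have h2 : enorm (d + s *: e) <= c2.
  apply: le_trans (enormD_le _ _) _; rewrite ler_pM2l// lerD2l enormZ.
  by rewrite ler_piMl// ltW.
have c2p : 0 < c2 := lt_le_trans p0 h2.
split=> //; have l1 : ln c1 <= ln (enorm (d + s *: e)) by rewrite ler_ln ?posrE.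
have l2 : ln (enorm (d + s *: e)) <= ln c2 by rewrite ler_ln ?posrE.
rewrite ler_norml; apply/andP; split.
  have := ler_norm (- ln c1); rewrite normrN; have := normr_ge0 (ln c2); lra.
by have := ler_norm (ln c2); have := normr_ge0 (ln c1); lra.
Qed.

End Growth.

(** * Growth rate along the chain of words *)

Section System.
Variables (R : realType) (X : finType) (E : rel X) (N : nat).
Variables (dv ev : window X N -> 'cV[R]_2) (good : window X N -> X -> bool).
Hypothesis good_basis : forall y a, good y a ->
  det2 (dv y) (ev y) != 0 /\ det2 (dv (wnext y a)) (ev (wnext y a)) != 0.
Hypothesis good_path : forall x : nat -> X, (forall n, E (x n) (x n.+1)) ->
  forall j, good (win N x j) (x (j + (N + N).+1)%N).
Variables (A : X -> R -> 'M[R]_2) (P : R -> X -> X -> R) (z0 : window X N).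
Implicit Types (y : window X N) (a : X) (t s : R) (x : nat -> X).

(** The default matrix sends every slope to 0 with factor 1: it meets the cone conditions and has
    zero logarithm. *)
Definition sys_mx t y a : 'M[R]_2 :=
  if good y a then
    trans_mx (A (wmid y) t) (dv y) (ev y) (dv (wnext y a)) (ev (wnext y a))
  else delta_mx 0 0.

Lemma sys_mx_analytic c y a i j : (forall i k l, analytic_at c (fun t => A i t k l)) ->
  analytic_at c (fun t => sys_mx t y a i j).
Proof.
move=> aA; rewrite /sys_mx; case: (good y a); last exact: analytic_at_cst.
have aM (v : 'cV[R]_2) k : analytic_at c (fun t => (A (wmid y) t *m v) k 0).
  under eq_fun do rewrite mulmx2E.
  by apply: analytic_atD; apply: analytic_atM => //; exact: analytic_at_cst.
have aN (f : R -> R) : analytic_at c f -> analytic_at c (fun t => - f t).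
  move=> fa; under eq_fun do rewrite -mulN1r.
  by apply: analytic_atM => //; exact: analytic_at_cst.
under eq_fun do rewrite mxE.
by case: (i == 0); case: (j == 0); apply: analytic_atM; do ?exact: analytic_at_cst;
  apply: analytic_atD; do ?apply: aN; apply: analytic_atM => //;
  exact: analytic_at_cst.
Qed.

Let next := @wnext X N.
Let lst := @wlast X N.
Let sys_g := gsum next lst P sys_mx.

Definition sys_lyap t := poisson_sol next lst P z0 sys_g t z0.

(** [corr] removes the dependence on the slope and [poisson_sol] solves the equation left on
    words. *)
Let H t y s := corr next lst P sys_mx t y s + poisson_sol next lst P z0 sys_g t y.

Variable t : R.
Hypothesis strict : forall y a, cone_strict (sys_mx t y a).
Hypothesis A_an : forall i k l, analytic_at t (fun t => A i t k l).
Hypothesis P_an : forall i a, analytic_at t (fun t => P t i a).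
Hypothesis P_st : row_stochastic (P t).
Hypothesis PE : forall i j, (0 < P t i j) = E i j.
Hypothesis reach : forall y, connect
  (fun y y' => [exists a, (0 < P t (lst y) a) && (next y a == y')]) y z0.

Let D_an y a i j : analytic_at t (fun t => sys_mx t y a i j).
Proof. exact: sys_mx_analytic. Qed.

Let K_unit : poisson_mx next lst (P t) z0 \in unitmx.
Proof. exact: (poisson_mx_unit P_st.1 P_st.2 reach). Qed.

Lemma sys_lyap_analytic : analytic_at t sys_lyap.
Proof.
have [g_an _] := @skew_poisson _ _ _ next lst P sys_mx t strict D_an P_an P_st.
exact: poisson_sol_analytic.
Qed.

Lemma sys_bounds : exists C : R, forall y a s, `|s| <= 1 ->
  [/\ den sys_mx t y a s != 0, `|slope sys_mx t y a s| <= 1,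
      `|logden sys_mx t y a s| <= C, `|H t y s| <= C &
      \sum_b P t (lst y) b * (logden sys_mx t y b s +
         H t (next y b) (slope sys_mx t y b s)) = H t y s + sys_lyap t].
Proof.
have [_ [C hC]] := @skew_poisson _ _ _ next lst P sys_mx t strict D_an P_an P_st.
pose K := \sum_y `|poisson_sol next lst P z0 sys_g t y|.
have KK y : `|poisson_sol next lst P z0 sys_g t y| <= K.
  by rewrite /K (bigD1 y)//= lerDl sumr_ge0.
exists (C + K) => y a s s1; have [h1 h2 h3 h4 h5] := hC y a s s1.
have K0 : 0 <= K := le_trans (normr_ge0 _) (KK y).
split=> //.
- by apply: le_trans h3 _; rewrite lerDl.
- by apply: le_trans (ler_normD _ _) _; exact: lerD.
- have e1 := @poisson_solP _ _ _ next lst P z0 sys_g t y K_unit.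
  under eq_bigr do rewrite mulrDr [_ * H _ _ _]mulrDr.
  rewrite big_split big_split /= -/(meanlog _ _ _ _ _ _) -/(pop _ _ _ _ _ _ _ _) /H.
  move: h5 e1; rewrite /meanlog /pop -/sys_g /sys_lyap => -> <-.
  by ring.
Qed.

Let C := sval (cid sys_bounds).
Let hC y a s : `|s| <= 1 ->
  [/\ den sys_mx t y a s != 0, `|slope sys_mx t y a s| <= 1,
      `|logden sys_mx t y a s| <= C, `|H t y s| <= C &
      \sum_b P t (lst y) b * (logden sys_mx t y b s +
         H t (next y b) (slope sys_mx t y b s)) = H t y s + sys_lyap t].
Proof. exact: (svalP (cid sys_bounds)). Qed.

Fixpoint sys_slope s0 x j : R :=
  if j is k.+1 then
    slope sys_mx t (win N x k) (x (k + (N + N).+1)%N) (sys_slope s0 x k)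
  else s0.

Lemma sys_slope_le1 s0 x j : `|s0| <= 1 -> `|sys_slope s0 x j| <= 1.
Proof. move=> s01; elim: j => [//|j ih].
by have [] := hC (win N x j) (x (j + (N + N).+1)%N) ih. Qed.

Lemma sys_slope_dep s0 j : depends_upto (j + (N + N)) (fun x => sys_slope s0 x j).
Proof.
elim: j => [//|j ih] x x' xx /=; rewrite (ih x x').
  by rewrite xx ?addnS ?addSn// (@eq_win _ _ x x')// => k kj; rewrite xx// ltnW// ltnS.
by move=> k kj; rewrite xx// addSn ltnW// ltnS.
Qed.

(** Martingale increment of the Poisson equation. Its sum differs from that of [logden] minus the
    exponent only by a telescoping, hence bounded, difference of values of [H]. *)
Let psi s0 j x := logden sys_mx t (win N x j) (x (j + (N + N).+1)%N) (sys_slope s0 x j)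
  + H t (win N x j.+1) (sys_slope s0 x j.+1)
  - (H t (win N x j) (sys_slope s0 x j) + sys_lyap t).

Let psi_dep s0 j : depends_upto (j + (N + N)).+1 (psi s0 j).
Proof.
move=> x x' xx; rewrite /psi.
have x1 k : (k <= j + (N + N))%N -> x k = x' k by move=> kj; rewrite xx// ltnW// ltnS.
rewrite (@sys_slope_dep s0 j x x')// (@sys_slope_dep s0 j.+1 x x')//.
by rewrite (@eq_win _ _ x x' j)// (@eq_win _ _ x x' j.+1)// xx// addnS.
Qed.

Let psi_mean s0 j x : `|s0| <= 1 ->
  \sum_a P t (x (j + (N + N))%N) a * psi s0 j (upd x (j + (N + N)).+1 a) = 0.
Proof.
move=> s01; set y := win N x j; set s := sys_slope s0 x j.
have s1 : `|s| <= 1 by exact: sys_slope_le1.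
rewrite (eq_bigr (fun a => P t (lst y) a * (logden sys_mx t y a s +
    H t (next y a) (slope sys_mx t y a s)) - P t (lst y) a * (H t y s + sys_lyap t))).
  rewrite sumrB -mulr_suml P_st.2 mul1r.
  by have [_ _ _ _ ->] := hC y (x 0%N) s1; rewrite subrr.
move=> a _; rewrite -mulrBr /lst win_last; congr (_ * _); rewrite /psi.
have x1 k : (k <= j + (N + N))%N -> upd x (j + (N + N)).+1 a k = x k.
  by move=> kj; rewrite /upd ltn_eqF.
have xa : upd x (j + (N + N)).+1 a (j + (N + N).+1)%N = a by rewrite /upd addnS eqxx.
have e1 : win N (upd x (j + (N + N)).+1 a) j = y := eq_win x1.
have e2 : sys_slope s0 (upd x (j + (N + N)).+1 a) j = s := sys_slope_dep s0 x1.
by rewrite -(@win_next X N (upd x (j + (N + N)).+1 a) j) [sys_slope _ _ j.+1]/= e1 e2 xa.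
Qed.

Let psi_bound s0 j x : `|s0| <= 1 -> `|psi s0 j x| <= C + C + (C + `|sys_lyap t|).
Proof.
move=> s01; have s1 := sys_slope_le1 x j s01; have s2 := sys_slope_le1 x j.+1 s01.
have [_ _ h1 h2 _] := hC (win N x j) (x (j + (N + N).+1)%N) s1.
have [_ _ _ h3 _] := hC (win N x j.+1) (x 0%N) s2.
apply: le_trans (ler_normB _ _) _; apply: lerD.
  by apply: le_trans (ler_normD _ _) _; apply: lerD.
by apply: le_trans (ler_normD _ _) _; rewrite lerD2r.
Qed.

Lemma sys_log_avg s0 x : `|s0| <= 1 ->
  (fun n => n%:R^-1 * \sum_(j < n) psi s0 j x) @ \oo --> (0 : R) ->
  (fun n => n%:R^-1 * \sum_(j < n)
     logden sys_mx t (win N x j) (x (j + (N + N).+1)%N) (sys_slope s0 x j)) @ \oo -->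
  sys_lyap t.
Proof.
move=> s01 cpsi; pose Hj j := H t (win N x j) (sys_slope s0 x j).
have HC j : `|Hj j| <= C.
  by have [] := hC (win N x j) (x 0%N) (sys_slope_le1 x j s01).
have hb : (fun n => n%:R^-1 * (Hj 0%N - Hj n)) @ \oo --> (0 : R).
  apply: (@cvg_avg_bounded _ _ (C + C)) => n.
  by apply: le_trans (ler_normB _ _) _; exact: lerD.
have : (fun n => n%:R^-1 * (\sum_(j < n) psi s0 j x) + n%:R^-1 * (Hj 0%N - Hj n) +
    sys_lyap t) @ \oo --> 0 + 0 + sys_lyap t.
  by apply: cvgnD; [exact: cvgnD|exact: cvgn_cst].
rewrite !add0r; apply: cvg_trans; apply: near_eq_cvg; exists 1%N => // n n1 /=.
have n0 : n%:R != 0 :> R by rewrite pnatr_eq0 -lt0n.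
rewrite -mulrDr; apply: (mulfI n0); rewrite mulrDr !(mulrA n%:R) divff// !mul1r.
have -> : \sum_(j < n) psi s0 j x = \sum_(j < n)
    logden sys_mx t (win N x j) (x (j + (N + N).+1)%N) (sys_slope s0 x j) +
    (Hj n - Hj 0%N) - n%:R * sys_lyap t.
  elim: n {n1 n0} => [|n ih]; first by rewrite !big_ord0; ring.
  by rewrite !big_ord_recr ih /= -natr1 /psi /Hj /=; ring.
by field.
Qed.

(** The step at the word [win N x j] uses the matrix of its middle letter [x (N + j)], so the
    product starts at time [N]. *)
Lemma sys_cocycle s0 x n : `|s0| <= 1 -> (forall k, E (x k) (x k.+1)) ->
  cocycle (fun i => A i t) (fun k => x (N + k)%N) n *m
    (dv (win N x 0) + s0 *: ev (win N x 0)) =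
  (\prod_(j < n) den sys_mx t (win N x j) (x (j + (N + N).+1)%N) (sys_slope s0 x j)) *:
    (dv (win N x n) + sys_slope s0 x n *: ev (win N x n)).
Proof.
move=> s01 xE; elim: n => [|n ih]; first by rewrite big_ord0 mul1mx scale1r.
rewrite /= -mulmxA ih -scalemxAr big_ord_recr /= -scalerA; congr (_ *: _).
have gd := good_path xE n.
have [de0 _ _ _ _] := hC (win N x n) (x (n + (N + N).+1)%N) (sys_slope_le1 x n s01).
move: de0; rewrite /slope /den /sys_mx gd win_next win_mid => de0.
apply: trans_mxP => //.
by have [_] := good_basis gd; rewrite win_next.
Qed.

Lemma sys_growth s0 x : `|s0| <= 1 -> (forall k, E (x k) (x k.+1)) ->
  (fun n => n%:R^-1 * \sum_(j < n) psi s0 j x) @ \oo --> (0 : R) ->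
  let M n := cocycle (fun i => A i t) (fun k => x (N + k)%N) n in
  let v := dv (win N x 0) + s0 *: ev (win N x 0) in
  (forall n, 0 < enorm (M n *m v)) /\
  (fun n => n%:R^-1 * ln (enorm (M n *m v))) @ \oo --> sys_lyap t.
Proof.
move=> s01 xE cpsi M v.
(* There are finitely many words, so the sum of these constants bounds the contribution of the
   moving bases; 0 stands in for a degenerate pair. *)
have /choice[K hK] y : exists K : R, 0 <= K /\ (det2 (dv y) (ev y) != 0 ->
    forall s : R, `|s| <= 1 ->
    0 < enorm (dv y + s *: ev y) /\ `|ln (enorm (dv y + s *: ev y))| <= K).
  have [d0|d0] := eqVneq (det2 (dv y) (ev y)) 0; first by exists 0.
  by have [K [K0 h]] := ln_enorm_cone d0; exists K.
pose vn n := dv (win N x n) + sys_slope s0 x n *: ev (win N x n).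
have vP n : 0 < enorm (vn n) /\ `|ln (enorm (vn n))| <= \sum_y K y.
  have [gb _] := good_basis (good_path xE n).
  have [h1 h2] := (hK _).2 gb _ (sys_slope_le1 x n s01); split=> //.
  apply: le_trans h2 _; rewrite (bigD1 (win N x n))//= lerDl sumr_ge0// => y _.
  by case: (hK y).
pose dn j := den sys_mx t (win N x j) (x (j + (N + N).+1)%N) (sys_slope s0 x j).
have dn0 j : 0 < `|dn j|.
  rewrite normr_gt0.
  by have [] := hC (win N x j) (x (j + (N + N).+1)%N) (sys_slope_le1 x j s01).
have eM n : enorm (M n *m v) = `|\prod_(j < n) dn j| * enorm (vn n).
  by rewrite /M /v sys_cocycle// enormZ.
have pr0 n : 0 < `|\prod_(j < n) dn j|.
  by rewrite normr_prod; apply: prodr_gt0 => j _; exact: dn0.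
split=> [n|]; first by rewrite eM mulr_gt0//; case: (vP n).
have : (fun n => n%:R^-1 * (\sum_(j < n)
     logden sys_mx t (win N x j) (x (j + (N + N).+1)%N) (sys_slope s0 x j)) +
     n%:R^-1 * ln (enorm (vn n))) @ \oo --> sys_lyap t + 0.
  apply: cvgnD; first exact: sys_log_avg.
  by apply: (@cvg_avg_bounded _ _ (\sum_y K y)) => n; case: (vP n).
rewrite addr0; apply: eq_cvgn => n; rewrite -mulrDr; congr (_ * _).
rewrite eM lnM ?posrE//; last by case: (vP n).
congr (_ + _); elim: n => [|n ih]; first by rewrite !big_ord0 normr1 ln1.
by rewrite !big_ord_recr /= ih normrM lnM ?posrE ?pr0 ?dn0.
Qed.

Hypothesis A_unit : forall i, A i t \in unitmx.

Lemma sys_lyap_exp : lyap_exp (fun i => A i t) (P t) (sys_lyap t).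
Proof.
move=> d T mu xi [p [[p0 p1 _] law]].
pose w : nat -> X := fun=> wlast z0.
have one1 : `|1 : R| <= 1 by rewrite normr1.
have zero1 : `|0 : R| <= 1 by rewrite normr0.
have slln s0 (s01 : `|s0| <= 1) := mart_slln w p0 p1 P_st.1 P_st.2 law
  (psi_dep s0) (fun j x => psi_mean j x s01) (fun j x => psi_bound j x s01).
have adm := ae_admissible w p0 p1 P_st.1 P_st.2 law.
apply: filterS3 adm (slln 0 zero1) (slln 1 one1) => om /= Pom c0 c1.
set x := xi om.
have xE k : E (x k) (x k.+1) by rewrite -PE.
have [q0 g0] := sys_growth zero1 xE c0; have [q1 g1] := sys_growth one1 xE c1.
pose M := fun i => A i t.
pose Z := cocycle M x N.
have Zu : Z \in unitmx by exact: cocycle_unit.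
pose v s := dv (win N x 0) + s *: ev (win N x 0).
have MZ n s : cocycle M x (N + n) *m (invmx Z *m v s) =
    cocycle M (fun k => x (N + k)%N) n *m v s.
  by rewrite cocycle_addn -/Z mulmxA mulmxK.
have [gb _] := good_basis (good_path xE 0%N).
(* [v 1 - v 0] is the second basis vector, so [v 0] and [v 1] span the plane, and pulling them back
   through the first [N] factors preserves this. *)
have det0 : det2 (invmx Z *m v 0) (invmx Z *m v 1) != 0.
  have -> : det2 (invmx Z *m v 0) (invmx Z *m v 1) =
     (invmx Z 0 0 * invmx Z 1 1 - invmx Z 0 1 * invmx Z 1 0) *
     det2 (dv (win N x 0)) (ev (win N x 0)).
    by rewrite /det2 !mulmx2E !mxE; ring.
  rewrite mulf_neq0//; have : \det (invmx Z) != 0.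
    by rewrite -unitfE -unitmxE unitmx_inv.
  by rewrite det2x2E.
suff : (fun n => n%:R^-1 * ln (opnorm (cocycle M x (N + n)))) @ \oo --> sys_lyap t.
  move=> /(cvg_avg_shift N) h; apply: (@cvgn_addnK _ _ _ N).
  by move: h; apply: eq_cvgn => n; rewrite [(N + n)%N]addnC.
apply: (ln_opnorm_growth det0).
- by move=> n; rewrite MZ.
- by move=> n; rewrite MZ.
- by under eq_fun do rewrite MZ.
- by under eq_fun do rewrite MZ.
Qed.

End System.

(** * The neighbourhood of the parameter and the analytic exponent *)

Lemma filter_forall_fin (T : Type) (F : set_system T) {FF : Filter F} (I : finType)
    (Q : I -> T -> Prop) :
  (forall i, \forall t \near F, Q i t) -> \forall t \near F, forall i, Q i t.
Proof.
move=> h; suff : \forall t \near F, forall i, i \in enum I -> Q i t.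
  by apply: filterS => t ht i; apply: ht; rewrite mem_enum.
elim: (enum I) => [|i s ih]; first by apply: filterE.
apply: filterS2 (h i) ih => t hi hs j; rewrite in_cons => /orP[/eqP ->//|].
exact: hs.
Qed.

Lemma cone_strict_delta (R : realType) : cone_strict (delta_mx 0 0 : 'M[R]_2).
Proof.
rewrite /cone_strict !mxE /= !(mulr0n, mulr1n) !mul0r !normr0 normr1 subr0 !add0r expr1n.
by rewrite ltr01.
Qed.

(** [connect] is reflexive and gives no edge by itself. A return path from a successor of [i] either
    ends with an edge into [i] or is empty, and then the successor is [i] itself. *)
Lemma strongly_connected_pred (X : finType) (E : rel X) :
  (forall i j, connect E i j) -> (forall i, exists j, E i j) ->
  forall i, exists j, E j i.
Proof.
move=> Ec Es i; have [k ik] := Es i; have [p pk ip] := connectP (Ec k i).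
case/lastP: p pk ip => [_ /= e|p z]; first by exists i; rewrite {2}e.
by rewrite rcons_path last_rcons => /andP[_ h] ->; exists (last k p).
Qed.

Theorem theorem5p1 (R : realType) (X : finType) (E : rel X)
  (J : set R) (P : R -> X -> X -> R) (A : X -> R -> 'M[R]_2) (t0 : R) :
  (forall i j : X, connect E i j) ->
  open J ->
  (forall x y z : R, J x -> J z -> x <= y -> y <= z -> J y) ->
  (forall t, J t -> row_stochastic (P t) /\ forall i j, (0 < P t i j) = E i j) ->
  (forall i j, real_analytic_on J (fun t => P t i j)) ->
  (forall i t, J t -> A i t \in unitmx) ->
  (forall i (k l : 'I_2), real_analytic_on J (fun t => A i t k l)) ->
  J t0 ->
  proj_unif_hyp E (fun i => A i t0) ->
  exists U : set R, [/\ open U, U t0, U `<=` J &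
    exists lam : R -> R, real_analytic_on U lam /\
      forall t, U t -> lyap_exp (fun i => A i t) (P t) (lam t)].
Proof.
move=> Econn oJ _ hP aP uA aA Jt0 puh.
have [[i0 _]|nX] := pselect (exists i : X, True); last first.
  (* Without states the entries of a stationary vector cannot sum to 1, so no Markov process exists
     and every value is an exponent. *)
  exists J; split=> //; exists (fun=> 0); split.
    by apply: wiener_analytic_on => c _; exact: analytic_at_cst.
  move=> t _ d T mu xi [p [[_ p1 _] _]].
  move: p1; rewrite big1 => [/esym/eqP|i]; first by rewrite oner_eq0.
  by case: nX; exists i.
have succ_ex i : exists j, E i j.
  apply: contrapT => /forallNP nE; have [[P0 P1] PE] := hP t0 Jt0.
  move: (P1 i); rewrite big1 => [/esym/eqP|j _]; first by rewrite oner_eq0.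
  by apply/eqP; rewrite eq_le P0 andbT leNgt PE; exact/negP/nE.
have pred_ex := strongly_connected_pred Econn succ_ex.
have [sc scE] := choice succ_ex.
pose x0 n := iter n sc i0.
have x0E n : E (x0 n) (x0 n.+1) by exact: scE.
have path_ex : exists x : nat -> X, forall n, E (x n) (x n.+1) by exists x0.
have [N [dv [ev [good [gb gs gp]]]]] :=
  hyperbolic_system (fun i => uA i t0 Jt0) pred_ex path_ex puh.
pose z0 := win N x0 0.
have A_an t : J t -> forall i k l, analytic_at t (fun t => A i t k l).
  by move=> Jt i k l; exact: real_analytic_at (aA i k l) Jt.
have P_an t : J t -> forall i a, analytic_at t (fun t => P t i a).
  by move=> Jt i a; exact: real_analytic_at (aP i a) Jt.
(* The bases remain those found at [t0]; [U] is where the finitely many strict inequalities persist,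
   and one formula gives the exponent on all of it. *)
pose U := [set t | J t /\ forall y a, cone_strict (sys_mx dv ev good A t y a)].
have reach t : J t -> forall y, connect (fun y y' : window X N =>
    [exists a, (0 < P t (wlast y) a) && (wnext y a == y')]) y z0.
  by move=> Jt; apply: (window_reach (hP t Jt).2 Econn).
exists U; split.
- rewrite openE => t [Jt ct]; rewrite /interior /=.
  have nJ : \forall s \near t, J s by exact: open_nbhs_nbhs.
  have nc : \forall s \near t, forall ya : window X N * X,
      cone_strict (sys_mx dv ev good A s ya.1 ya.2).
    apply: (@filter_forall_fin _ (nbhs t) _ (window X N * X)%type
      (fun ya s => cone_strict (sys_mx dv ev good A s ya.1 ya.2))) => -[y a] /=.
    apply: cone_strict_near (ct y a) => i j.
    by apply: analytic_continuous; apply: sys_mx_analytic; exact: A_an.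
  by apply: filterS2 nJ nc => s Js cs; split=> // y a; exact: (cs (y, a)).
- split=> // y a; rewrite /sys_mx; case: ifP => [/gs//|_].
  exact: cone_strict_delta.
- by move=> t [].
- exists (sys_lyap dv ev good A P z0); split.
    apply: wiener_analytic_on => t [Jt ct]; have [Pst PE] := hP t Jt.
    by apply: sys_lyap_analytic => //; [exact: A_an|exact: P_an|exact: reach].
  move=> t [Jt ct]; have [Pst PE] := hP t Jt.
  apply: (@sys_lyap_exp _ _ E) => //; [exact: A_an|exact: P_an|exact: reach|].
  by move=> i; exact: uA.
Qed.
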